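(* (Exact ratio approach.) In the deep inverse Rosenblatt transport (DIRT) setting described in the context, let $k\ge1$ and let $$q_k(u)=\left(\frac{(\pi_k\circ\bar T_{k-1})(u)}{(\hat\pi_{k-1}\circ\bar T_{k-1})(u)}\,\frac{f_U(u)}{\omega(u)}\right)^{1/2},\qquad u\in\mathcal U .$$ Suppose the tensor-train function $\tilde g_k$ and the constant $\gamma_k$ satisfy $$\|\tilde g_k-q_k\|_{L^2_\omega(\mathcal U)}\le\epsilon_k\qquad\text{and}\qquad \gamma_k\le\frac1{\omega(\mathcal U)}\|\tilde g_k-q_k\|^2_{L^2_\omega(\mathcal U)} .$$ Then $$\big\|\sqrt{\pi_k}-\sqrt{\hat\pi_k}\big\|_{L^2_\lambda(\mathcal X)}\le\sqrt{2\,\bar z_{k-1}}\;\epsilon_k,$$ where $\bar z_{k-1}=\prod_{j=0}^{k-1}\hat z_j$ is the normalising constant of $\hat\pi_{k-1}$.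
   Context: Spaces and weights: $\mathcal X=\prod_{i=1}^d\mathcal X_i$, $\mathcal U=\prod_{i=1}^d\mathcal U_i$ with $\mathcal X_i,\mathcal U_i\subseteq\mathbb R$; $\lambda(x)=\prod_i\lambda_i(x_i)$ and $\omega(u)=\prod_i\omega_i(u_i)$ are product weight functions (positive), with $\lambda(\mathcal X)=\int_{\mathcal X}\lambda$ and $\omega(\mathcal U)=\int_{\mathcal U}\omega$ finite. $\|f\|_{L^2_\lambda(\mathcal X)}^2=\int_{\mathcal X}f^2\lambda\,dx$ and $\|g\|_{L^2_\omega(\mathcal U)}^2=\int_{\mathcal U}g^2\omega\,du$. Reference: $\mu$ is a product probability measure on $\mathcal U$ with density $f_U(u)=\prod_i f_{U_i}(u_i)>0$; $R(u)=(F_{U_1}(u_1),\ldots,F_{U_d}(u_d))$ is the map of its marginal cumulative distribution functions, so $R_\sharp\mu=\mu_{\rm uni}$, the uniform measure on $[0,1]^d$. Bridging densities: $\pi_0,\ldots,\pi_L$ are nonnegative unnormalised densities on $\mathcal X$ with $z_k=\int_{\mathcal X}\pi_k\lambda\,dx\in(0,\infty)$; $\nu_k$ is the probability measure with density $\frac1{z_k}\pi_k\lambda$. The inverse Rosenblatt transport of a density $p$ on a product domain is the inverse of the lower-triangular map $(F_1(x_1),F_2(x_2|x_1),\ldots,F_d(x_d|x_{1},\ldots,x_{d-1}))$ of its marginal/conditional cumulative distribution functions; it pushes $\mu_{\rm uni}$ forward to the measure with density $p$. DIRT: Layer $0$: $\tilde g_0:\mathcal X\to\mathbb R$ is a tensor-train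 function (product of univariate matrix-valued functions $\mathsf G_1(x_1)\cdots\mathsf G_d(x_d)$, a scalar), $\gamma_0>0$, $\hat z_0=\gamma_0\lambda(\mathcal X)+\int_{\mathcal X}\tilde g_0^2\lambda\,dx$, and $\hat T_0:[0,1]^d\to\mathcal X$ is the inverse Rosenblatt transport of $\hat f_0(x)=\frac1{\hat z_0}(\gamma_0+\tilde g_0(x)^2)\lambda(x)$. Layers $j\ge1$: $\tilde g_j:\mathcal U\to\mathbb R$ is a tensor-train function, $\gamma_j>0$, $\hat z_j=\gamma_j\omega(\mathcal U)+\int_{\mathcal U}\tilde g_j^2\omega\,du$, and $\hat T_j:[0,1]^d\to\mathcal U$ is the inverse Rosenblatt transport of $\hat p_j(u)=\frac1{\hat z_j}(\gamma_j+\tilde g_j(u)^2)\omega(u)$. The composition is $\bar T_j=(\hat T_0\circ R)\circ(\hat T_1\circ R)\circ\cdots\circ(\hat T_j\circ R):\mathcal U\to\mathcal X$. The maps are treated as diffeomorphisms (up to null sets), so the change of variables formula for densities applies. Approximate densities: with $\bar z_k=\prod_{j=0}^k\hat z_j$, $$\hat\pi_k(x)=\big(\gamma_0+\tilde g_0(x)^2\big)\prod_{j=1}^k\frac{\big(\gamma_j+(\tilde g_j\circ\bar T_{j-1}^{-1})(x)^2\big)\,(\omega\circ\bar T_{j-1}^{-1})(x)}{(f_U\circ\bar T_{j-1}^{-1})(x)} ,$$ and $(\bar T_k)_\sharp\mu$ has the density $\frac1{\bar z_k}\hat\pi_k(x)\lambda(x)$. *)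

(* Defs.v *)
From HB Require Import structures.
From mathcomp Require Import all_boot all_order all_algebra.
From mathcomp Require Import all_classical all_reals all_analysis.

Set Implicit Arguments.
Unset Strict Implicit.
Unset Printing Implicit Defensive.

Import Order.TTheory GRing.Theory Num.Theory.
Import numFieldNormedType.Exports.

Local Open Scope classical_set_scope.
Local Open Scope ring_scope.

Notation point R d := (d.-tuple (measurableTypeR R)).

Section lebesgue_tuple.
Context (R : realType).

Definition consR (d : nat) (z : measurableTypeR R * point R d) : point R d.+1 :=
  [tuple of z.1 :: z.2].

Lemma measurable_consR d : measurable_fun setT (@consR d).
Proof.
apply: (@measurable_cons _ _ _ _ fst d snd).
  exact: measurable_fst.
exact: measurable_snd.
Qed.

Section step.
Context (d : nat) (m : {sigma_finite_measure set (point R d) -> \bar R}).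

Definition leb_step : set (point R d.+1) -> \bar R :=
  pushforward (lebesgue_measure \x m)%E (@consR d).

Let measurable_pre A : measurable A -> measurable (@consR d @^-1` A).
Proof. by move=> mA; rewrite -[X in measurable X]setTI; exact: measurable_consR. Qed.

Let leb_step0 : leb_step set0 = 0%E.
Proof. by rewrite /leb_step /pushforward preimage_set0 measure0. Qed.

Let leb_step_ge0 A : (0 <= leb_step A)%E.
Proof. by rewrite /leb_step /pushforward; apply: measure_ge0. Qed.

Let leb_step_additive : semi_sigma_additive leb_step.
Proof.
move=> F mF tF mUF; rewrite /leb_step /pushforward preimage_bigcup.
apply: measure_semi_sigma_additive.
- by move=> n; exact: measurable_pre.
- apply/trivIsetP => /= i j _ _ ij; rewrite -preimage_setI.
  by move/trivIsetP : tF => /(_ _ _ _ _ ij) ->//; rewrite preimage_set0.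
- by rewrite -preimage_bigcup; exact: measurable_pre.
Qed.

HB.instance Definition _ := isMeasure.Build _ _ _ leb_step
  leb_step0 leb_step_ge0 leb_step_additive.

Let leb_step_sigma_finite : sigma_finite setT leb_step.
Proof.
have /sigma_finiteP[F [TF ndF Foo]] :=
  sigma_finiteT (@lebesgue_measure R : {sigma_finite_measure set _ -> \bar R}).
have /sigma_finiteP[G [TG ndG Goo]] := sigma_finiteT m.
pose spl (x : point R d.+1) := (thead x, [tuple of behead x]).
have mspl : measurable_fun setT spl.
  apply/measurable_fun_pairP; split; last exact: measurable_behead.
  exact: measurable_tnth.
have splK z : spl (consR z) = z.
  by case: z => t x; congr pair; exact: val_inj.
exists (fun n => spl @^-1` (F n `*` G n)).
  apply/seteqP; split => // x _.
  have [n _ Fx] : (\bigcup_i F i) (thead x) by rewrite -TF.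
  have [k _ Gx] : (\bigcup_i G i) [tuple of behead x] by rewrite -TG.
  exists (maxn n k) => //; split => /=.
    by move: Fx; exact/subsetPset/ndF/leq_maxl.
  by move: Gx; exact/subsetPset/ndG/leq_maxr.
move=> n; have [? ?] := Foo n; have [? ?] := Goo n; split.
  by rewrite -[X in measurable X]setTI; apply: mspl => //; exact: measurableX.
rewrite /leb_step /pushforward (_ : _ @^-1` _ = F n `*` G n); last first.
  by rewrite -comp_preimage (_ : _ \o _ = id)//; exact/funext/splK.
by rewrite product_measure1E// lte_mul_pinfty// ge0_fin_numE.
Qed.

HB.instance Definition _ := Measure_isSigmaFinite.Build _ _ _ leb_step
  leb_step_sigma_finite.

End step.

Fixpoint leb (d : nat) : {sigma_finite_measure set (point R d) -> \bar R} :=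
  match d with
  | 0 => @dirac _ (point R 0) [tuple] R
  | d'.+1 => leb_step (leb d')
  end.

End lebesgue_tuple.
Arguments leb {R} d.

Section functions.
Context (R : realType).

Definition box d (D : 'I_d -> set R) : set (point R d) :=
  [set x | forall i, D i (tnth x i)].

Definition cube d : set (point R d) := box (fun=> `[0, 1]%classic).

Definition prodf d (w : 'I_d -> R -> R) (x : point R d) : R :=
  \prod_(i < d) w i (tnth x i).

(* Weighted norm (\int_D f^2 w)^(1/2); it is +oo when f is not in the space. *)
Definition L2norm d (D : set (point R d)) (w f : point R d -> R) : \bar R :=
  sqrte (\int[leb d]_(x in D) (f x ^+ 2 * w x)%:E)%E.

Definition density_cdf (D : set R) (f : R -> R) (t : R) : R :=
  \int[lebesgue_measure]_(s in D `&` `]-oo, t]%classic) f s.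

(* The map (F_1(x_1), F_2(x_2 | x_1), ..., F_d(x_d | x_1, ..., x_(d-1))) of a
   probability density p on box D: F_1 is the distribution function of the
   first marginal of p, and the other components are the same map for the
   conditional density of (x_2, ..., x_d) given x_1. At the null set of x_1 whose
   marginal density is infinite, the real-valued integral is 0 by convention. *)
Definition marginal1 d (D : 'I_d.+1 -> set R) (p : point R d.+1 -> R) (t : R) : R :=
  \int[leb d]_(y in box (fun i => D (lift ord0 i))) p (consR (t, y)).

Definition conditional1 d (D : 'I_d.+1 -> set R) (p : point R d.+1 -> R) (t : R)
    (y : point R d) : R :=
  p (consR (t, y)) / marginal1 D p t.

Fixpoint rosenblatt (d : nat) :
    ('I_d -> set R) -> (point R d -> R) -> point R d -> point R d :=
  match d with
  | 0 => fun _ _ x => x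
  | d'.+1 => fun D p x =>
      consR (density_cdf (D ord0) (marginal1 D p) (thead x),
             rosenblatt (fun i => D (lift ord0 i)) (conditional1 D p (thead x))
               [tuple of behead x])
  end.

(* h : E -> D is the inverse of f : D -> E up to Lebesgue-null sets. *)
Definition ae_inverse d (D E : set (point R d)) (f h : point R d -> point R d) :=
  [/\ measurable_fun E h,
      forall y, E y -> D (h y),
      {ae leb d, forall x, D x -> h (f x) = x} &
      {ae leb d, forall y, E y -> f (h y) = y}].

Definition inverse_rosenblatt d (D : 'I_d -> set R) (p : point R d -> R)
    (T : point R d -> point R d) :=
  ae_inverse (box D) (@cube d) (rosenblatt D p) T.

Fixpoint tt_product (r : nat -> nat) (G : forall i, R -> 'M[R]_(r i, r i.+1))
    (x : nat -> R) (n : nat) : 'M[R]_(r 0, r n) :=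
  match n with
  | 0 => 1%:M
  | n'.+1 => tt_product G x n' *m G n' (x n')
  end.

(* The boundary ranks are 1, so the matrix product has a single entry. *)
Definition tensor_train d (D : set (point R d)) (g : point R d -> R) :=
  exists (r : nat -> nat) (G : forall i, R -> 'M[R]_(r i, r i.+1)),
    [/\ r 0 = 1%N, r d = 1%N &
        forall x, D x -> forall i j, g x = tt_product G (nth 0 x) d i j].

Definition product_weight d (D : 'I_d -> set R) (w : 'I_d -> R -> R) :=
  [/\ forall i, measurable_fun (D i) (w i),
      forall i t, D i t -> 0 < w i t &
      (\int[leb d]_(x in box D) (prodf w x)%:E < +oo)%E].

Definition product_density d (D : 'I_d -> set R) (f : 'I_d -> R -> R) :=
  [/\ forall i, measurable_fun (D i) (f i),
      forall i t, D i t -> 0 < f i t &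
      forall i, (\int[lebesgue_measure]_(t in D i) (f i t)%:E = 1)%E].

Definition sq_density d (w : point R d -> R) (c : R) (g : point R d -> R)
    (x : point R d) : R :=
  (c + g x ^+ 2) * w x.

Definition sq_mass d (D : set (point R d)) (w : point R d -> R) (c : R)
    (g : point R d -> R) : R :=
  c * \int[leb d]_(x in D) w x + \int[leb d]_(x in D) (g x ^+ 2 * w x).

Definition tt_approximant d (D : set (point R d)) (w g : point R d -> R) :=
  [/\ tensor_train D g, measurable_fun D g &
      (\int[leb d]_(x in D) (g x ^+ 2 * w x)%:E < +oo)%E].

Record dirt (d : nat) := Dirt {
  domX : 'I_d -> set R;
  domU : 'I_d -> set R;
  lambda : 'I_d -> R -> R;
  omega : 'I_d -> R -> R;
  refd : 'I_d -> R -> R;                       (* marginal densities of the reference *)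
  gam : nat -> R;
  gtt : nat -> point R d -> R;                  (* tensor trains, layer by layer *)
  That : nat -> point R d -> point R d;        (* inverse Rosenblatt transports *)
  Tbar_inv : nat -> point R d -> point R d     (* inverses of the Tbar below *)
}.

Section dirt.
Context (d : nat) (M : dirt d).

Definition boxX := box (domX M).
Definition boxU := box (domU M).
Definition lambdaX := prodf (lambda M).
Definition omegaU := prodf (omega M).
Definition fU := prodf (refd M).

Definition refmap (u : point R d) : point R d :=
  [tuple density_cdf (domU M i) (refd M i) (tnth u i) | i < d].

Fixpoint Tbar (j : nat) : point R d -> point R d :=
  match j with
  | 0 => That M 0 \o refmap
  | j'.+1 => Tbar j' \o (That M j \o refmap)
  end.

Definition zhat (j : nat) : R :=
  if j is 0 then sq_mass boxX lambdaX (gam M 0) (gtt M 0)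
  else sq_mass boxU omegaU (gam M j) (gtt M j).

Definition zbar (k : nat) : R := \prod_(0 <= j < k.+1) zhat j.

Definition pihat (k : nat) (x : point R d) : R :=
  (gam M 0 + gtt M 0 x ^+ 2) *
  \prod_(1 <= j < k.+1)
     ((gam M j + gtt M j (Tbar_inv M j.-1 x) ^+ 2) * omegaU (Tbar_inv M j.-1 x)
      / fU (Tbar_inv M j.-1 x)).

Definition exact_ratio (pik : point R d -> R) (k : nat) (u : point R d) : R :=
  Num.sqrt (pik (Tbar k.-1 u) / pihat k.-1 (Tbar k.-1 u) * (fU u / omegaU u)).

Definition layer (j : nat) : Prop :=
  if j is 0 then
    [/\ 0 < gam M 0, tt_approximant boxX lambdaX (gtt M 0) &
        inverse_rosenblatt (domX M)
          (fun x => (zhat 0)^-1 * sq_density lambdaX (gam M 0) (gtt M 0) x)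
          (That M 0)]
  else
    [/\ 0 < gam M j, tt_approximant boxU omegaU (gtt M j) &
        inverse_rosenblatt (domU M)
          (fun u => (zhat j)^-1 * sq_density omegaU (gam M j) (gtt M j) u)
          (That M j)].

(* Layers 0, ..., L. That the transports push the uniform measure on the cube, or
   the reference measure, to the stated densities is not assumed: it follows
   from inverse_rosenblatt and from the definition of refmap. *)
Definition dirt_setting (L : nat) : Prop :=
  [/\ (forall i, measurable (domX M i)) /\ (forall i, measurable (domU M i)),
      product_weight (domX M) (lambda M) /\ product_weight (domU M) (omega M),
      product_density (domU M) (refd M),
      forall j, (j <= L)%N -> layer j &
      forall j, (j <= L)%N -> ae_inverse boxU boxX (Tbar j) (Tbar_inv M j)].

Definition bridging_density (pik : point R d -> R) : Prop :=
  [/\ measurable_fun boxX pik,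
      forall x, boxX x -> 0 <= pik x &
      (0 < \int[leb d]_(x in boxX) (pik x * lambdaX x)%:E < +oo)%E].

End dirt.
End functions.

(* Main.v *)
(** The Rosenblatt map of a density p pushes p forward to the uniform density on the
   cube: in dimension one this is the probability integral transform, and Tonelli's
   theorem reduces the general case to it by conditioning on the first coordinate.
   An almost everywhere inverse therefore pushes the uniform density forward to p,
   and by induction Tbar_k pushes the reference density f_U forward to
   pihat_k lambda / zbar_k.
   Changing variables by x = Tbar_(k-1)(u), the squared error on X becomes
   zbar_(k-1) times the integral of (q_k - sqrt (gamma_k + g_k^2))^2 omega.  The
   triangle inequality in the plane, applied to the vectors (q_k, 0) and
   (g_k, sqrt gamma_k), bounds the integrand by ((g_k - q_k)^2 + gamma_k) omega, and
   by the choice of gamma_k the second term integrates to at most the first. *)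

From HB Require Import structures.
Require Import Defs.
From mathcomp Require Import all_boot all_order all_algebra.
From mathcomp Require Import all_classical all_reals all_analysis.
From mathcomp Require Import measurable_realfun.
From mathcomp Require Import ring lra.

Set Implicit Arguments.
Unset Strict Implicit.
Unset Printing Implicit Defensive.

Import Order.TTheory GRing.Theory Num.Theory.
Import numFieldNormedType.Exports.

Local Open Scope classical_set_scope.
Local Open Scope ring_scope.

(** The maps are only measurable, with inverses up to null sets, so no Jacobian occurs: the
    pushforward of a density is an integral identity for all nonnegative measurable test functions,
    a form that can be composed, inverted and reweighted. Two obstacles shape the rest. A
    conditional density is degenerate on fibres where the marginal is 0 or infinite, so some
    inductions carry mass at most 1 instead of mass 1, and the others discard null sets of fibres.
    And [pihat] is written with [Tbar_inv], which cancels against [Tbar] only almost everywhere. *)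

Local Notation vec R d := (d.-tuple (measurableTypeR R)).

(** * Measures with a density and the probability integral transform *)

Section density_measure.
Local Open Scope ereal_scope.
Context d (T : measurableType d) (R : realType).
Variables (mu : {measure set T -> \bar R}) (f : T -> R).
Hypotheses (mf : measurable_fun setT f) (f0 : forall x, (0 <= f x)%R).

(** The two proofs are arguments of the term, so that the measure structure declared below can be
    inferred from it. *)
Definition density_measure of measurable_fun setT f & forall x, (0 <= f x)%R :=
  fun A : set T => \int[mu]_(x in A) (f x)%:E.

Local Notation nu := (density_measure mf f0).

Let nu0 : nu set0 = 0.
Proof. exact: integral_set0. Qed.

Let nu_ge0 A : 0 <= nu A.
Proof. by apply: integral_ge0 => x _; rewrite lee_fin. Qed.

Let nu_sigma_additive : semi_sigma_additive nu.
Proof.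
apply: semi_sigma_additive_nng_induced; first exact/measurable_EFinP.
by move=> x; rewrite lee_fin.
Qed.

HB.instance Definition _ := isMeasure.Build _ _ _ nu nu0 nu_ge0 nu_sigma_additive.

Import HBNNSimple.

Let integral_nnsfun (h : {nnsfun T >-> R}) :
  \int[nu]_x (h x)%:E = \int[mu]_x ((h x)%:E * (f x)%:E).
Proof.
under [LHS]eq_integral do rewrite fimfunE -fsumEFin//.
rewrite [LHS]ge0_integral_fsum//; last 2 first.
  - by move=> r; exact/measurable_EFinP/measurableT_comp.
  - by move=> n x _; rewrite EFinM nnfun_muleindic_ge0.
under [RHS]eq_integral.
  move=> x _; rewrite fimfunE -fsumEFin// ge0_mule_fsuml; last first.
    by move=> r; rewrite EFinM nnfun_muleindic_ge0.
  over.
rewrite [RHS]ge0_integral_fsum//; last 2 first.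
  - move=> r; apply: emeasurable_funM; last exact/measurable_EFinP.
    by apply/measurable_EFinP; apply/measurableT_comp.
  - move=> n x _; apply: mule_ge0; last by rewrite lee_fin.
    by rewrite EFinM nnfun_muleindic_ge0.
apply: eq_fsbigr => r _.
have [r0|r0] := leP 0%R r; last first.
  rewrite !integral0_eq// => x _; have := nnfun_muleindic_ge0 h r x;
  rewrite preimage_nnfun0// indic0 EFinM mule0//.
  by rewrite mul0e.
under eq_integral do rewrite EFinM.
rewrite ge0_integralZl//; last exact/measurable_EFinP.
rewrite integral_indic// setIT.
rewrite -[X in _ * X]/(\int[mu]_(x in h @^-1` [set r]) (f x)%:E).
rewrite [in LHS]integral_mkcond.
under [RHS]eq_integral => x _ do rewrite EFinM -muleA.
rewrite ge0_integralZl//; first last.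
- by move=> x _; rewrite -EFinM lee_fin mulr_ge0.
- by apply: emeasurable_funM; exact/measurable_EFinP.
congr (_ * _); apply: eq_integral => x _.
by rewrite patchE indicE; case: ifPn => _; rewrite ?mul1e ?mul0e.
Qed.

(** The case of simple functions passes to the limit by monotone convergence on both sides. *)
Lemma integral_density_measure (h : T -> \bar R) :
  measurable_fun setT h -> (forall x, 0 <= h x) ->
  \int[nu]_x h x = \int[mu]_x (h x * (f x)%:E).
Proof.
move=> mh h0; pose h_ := nnsfun_approx measurableT mh.
have nd_h m n x : (m <= n)%N -> (h_ m x)%:E <= (h_ n x)%:E.
  by move=> mn; rewrite lee_fin; exact/lefP/nd_nnsfun_approx.
have cvg_h x : (h_ n x)%:E @[n --> \oo] --> h x by exact: cvg_nnsfun_approx.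
transitivity (lim (\int[nu]_x (h_ n x)%:E @[n --> \oo])).
  rewrite -monotone_convergence//=.
  - by apply: eq_integral => x _; apply/esym/cvg_lim => //; exact: cvg_h.
  - by move=> n; exact/measurable_EFinP/measurable_funTS.
  - by move=> n ? _; rewrite lee_fin.
  - by move=> x _ m n mn; exact: nd_h.
under eq_fun do rewrite integral_nnsfun.
rewrite -monotone_convergence//=.
- apply: eq_integral => x _; apply/cvg_lim => //.
  exact: cvgeZr (cvg_h x).
- move=> n; apply: emeasurable_funM; last exact/measurable_EFinP.
  exact/measurable_EFinP/measurable_funTS.
- by move=> n x _; rewrite -EFinM lee_fin mulr_ge0.
- by move=> x _ m n mn; apply: lee_wpmul2r; [rewrite lee_fin | exact: nd_h].
Qed.

End density_measure.

Section cdf_uniform.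
Context (R : realType) (f : R -> R).
Local Notation mu := (@lebesgue_measure R).
Hypotheses (mf : measurable_fun (setT : set (measurableTypeR R)) f)
  (f0 : forall x, 0 <= f x) (f1 : (\int[mu]_x (f x)%:E = 1)%E).

Let P : set (measurableTypeR R) -> \bar R := density_measure mu mf f0.

HB.instance Definition _ := Measure.on P.

Let PT : P setT = 1%E. Proof. exact: f1. Qed.

HB.instance Definition _ := Measure_isProbability.Build _ _ _ P PT.

Let P_le1 (A : set (measurableTypeR R)) : measurable A -> (P A <= 1)%E.
Proof. exact: (probability_le1 P). Qed.

Let G : measurableTypeR R -> measurableTypeR R := density_cdf setT f.

Let GE t : (G t)%:E = P `]-oo, t].
Proof.
rewrite /G /density_cdf /Rintegral setTI fineK//.
by rewrite -[X in X \is a fin_num]/(P `]-oo, t]) fin_num_measure.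
Qed.

Let G_nd : {homo G : s t / s <= t}.
Proof.
move=> s t st; rewrite -lee_fin !GE; apply: le_measure; rewrite ?inE//.
exact: subset_itvl.
Qed.

Let mG : measurable_fun (setT : set (measurableTypeR R)) G.
Proof. exact: nondecreasing_measurable. Qed.

(** On [[a, +oo[] this shows [G] as a constant plus an integral with moving endpoint, the form whose
    continuity is known. *)
Let G_split a t : a <= t -> G t = G a + parameterized_integral mu a t f.
Proof.
move=> at_; apply: EFin_inj; rewrite EFinD !GE.
rewrite (@itv_bndbnd_setU _ _ -oo%O (BRight a) (BRight t))//.
rewrite measureU//; last first.
  by apply/seteqP; split => // x [] /=; rewrite !in_itv/= => xa /andP[]; rewrite ltNge xa.
congr (_ + _)%E; rewrite /parameterized_integral /Rintegral fineK; last first.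
  by rewrite -[X in X \is a fin_num]/(P `[a, t]) fin_num_measure.
rewrite -[LHS]/(\int[mu]_(x in `]a, t]) (f x)%:E)%E.
rewrite integral_itv_obnd_cbnd//.
by apply/measurable_EFinP; exact: measurable_funTS.
Qed.

(* A law with a density has no atoms, so its distribution function is continuous
   and the intermediate value theorem applies. *)
Let G_surj (v : R) : 0 < v < 1 -> exists t, G t = v.
Proof.
move=> /andP[v0 v1].
have cvP : P `](- n%:R)%R, n%:R]%classic @[n --> \oo] --> 1%E.
  rewrite -PT (_ : setT = \bigcup_n `](- n%:R)%R, n%:R]%classic); last first.
    apply/seteqP; split => // x _; exists (Num.truncn `|x|).+1 => //=.
    rewrite in_itv/=; have := truncnS_gt `|x|.
    by rewrite ltr_norml => /andP[-> /ltW ->].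
  apply: nondecreasing_cvg_mu => //.
    exact: bigcup_measurable.
  move=> m n mn; apply/subsetPset; apply: subset_itv; rewrite bnd_simp.
    by rewrite lerN2 ler_nat.
  by rewrite ler_nat.
(* Mass above [v] in the window gives [v < G n]; mass above [1 - v] leaves less than [v] to its
   left, so [G (- n) < v]. *)
have [n Pn] : exists n, ((Num.max v (1 - v))%:E < P `](- n%:R)%R, n%:R])%E.
  have : ((Num.max v (1 - v))%:E < 1)%E by rewrite lte_fin gt_max v1 gtrBl.
  move=> /open_ereal_gt' /cvP [n _ Pn].
  by exists n; apply: Pn => /=.
have nn : - n%:R <= n%:R :> R by rewrite lerNl (le_trans _ (ler0n R n))// oppr_le0.
have Gn : v < G n%:R.
  rewrite -lte_fin GE (le_lt_trans _ (lt_le_trans Pn _))//.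
    by rewrite lee_fin le_max lexx.
  by apply: le_measure; rewrite ?inE//; exact: subset_itvr.
have GNn : G (- n%:R) < v.
  have : (P `]-oo, (- n%:R)%R] + P `](- n%:R)%R, n%:R] <= 1)%E.
    rewrite -measureU//; first by apply: P_le1; exact: measurableU.
    apply/seteqP; split => // x [] /=; rewrite !in_itv/= => xa /andP[].
    by rewrite ltNge xa.
  rewrite -GE => le1; rewrite -lte_fin.
  have : ((1 - v)%:E < P `](- n%:R)%R, n%:R])%E.
    by apply: le_lt_trans Pn; rewrite lee_fin le_max lexx orbT.
  have : P `](- n%:R)%R, n%:R] \is a fin_num by rewrite fin_num_measure.
  move: le1; case: (P _) => // p; rewrite -EFinD !lee_fin !lte_fin => + _.
  lra.
pose h t := G (- n%:R) + parameterized_integral mu (- n%:R) t f.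
have ch : {within `[(- n%:R)%R, n%:R]%classic, continuous h}.
  have int_f : mu.-integrable `[(- n%:R)%R, n%:R] (EFin \o f).
    apply: (integrableS measurableT) => //.
    apply/integrableP; split; first exact/measurable_EFinP.
    by under eq_integral do rewrite /= ger0_norm//; rewrite f1 ltry.
  have cp := parameterized_integral_continuous nn int_f.
  by move=> t; apply: cvgD (cp t); exact: cvg_cst.
have [||t tn htv] := @IVT R h (- n%:R) n%:R v _ ch => //.
  have hn t : - n%:R <= t -> h t = G t by move=> ?; rewrite /h -G_split.
  by rewrite !hn// ge_min le_max (ltW GNn) (ltW Gn) orbT.
exists t; rewrite -htv /h -G_split//.
by move: tn; rewrite in_itv/= => /andP[].
Qed.

(** [G] may be constant on intervals, so it is not inverted: its sublevel set is squeezed between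
    rays ending at points where [G] equals [a] or slightly less. The value 1 need not be attained,
    so for [a = 1] the upper bound is the total mass. *)
Let PG (a : R) : 0 < a <= 1 -> P (G @^-1` `]-oo, a[) = a%:E.
Proof.
move=> /andP[a0 a1]; have mGa : measurable (G @^-1` `]-oo, a[).
  by rewrite -[X in measurable X]setTI; exact: mG.
apply/eqP; rewrite eq_le; apply/andP; split.
  have [a1'|aN1] := eqVneq a 1; first by rewrite {2}a1'; exact: P_le1.
  have {aN1}a1 : a < 1 by rewrite lt_neqAle aN1.
  have [|t Gt] := @G_surj a; first by rewrite a0.
  rewrite -{2}Gt GE; apply: le_measure; rewrite ?inE// => s /=.
  rewrite !in_itv/= => Gs; rewrite leNgt; apply/negP => /ltW/G_nd.
  by rewrite leNgt Gt Gs.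
apply/lee_subgt0Pr => e e0.
(* The term [a / 2] keeps [b] positive, as [G_surj] requires; the term [a - e] gives the
   precision. *)
pose b := Num.max (a / 2) (a - e).
have ba : b < a by rewrite gt_max; apply/andP; split; lra.
have b0 : 0 < b by rewrite lt_max; apply/orP; left; lra.
have [|t Gt] := @G_surj b; first by rewrite b0 (lt_le_trans ba).
apply: (@le_trans _ _ b%:E).
  by rewrite -EFinB lee_fin le_max lexx orbT.
rewrite -Gt GE; apply: le_measure; rewrite ?inE// => s /=.
by rewrite !in_itv/= => /G_nd /le_lt_trans; apply; rewrite Gt.
Qed.

Let G_ge0 t : 0 <= G t.
Proof. by rewrite -lee_fin GE. Qed.

Let G_le1 t : G t <= 1.
Proof. by rewrite -lee_fin GE; exact: P_le1. Qed.

Let m01 : measurable_fun setT (\1_`[0, 1]%classic : measurableTypeR R -> R).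
Proof. exact: measurable_indic. Qed.

Let ind01 (x : R) : 0 <= (\1_`[0, 1]%classic x : R).
Proof. by rewrite indicE. Qed.

(** Open rays are stable under intersection, generate the Borel sets and exhaust the line, so two
    measures that are finite and equal on them coincide. The uniform law appears as the density
    [\1_[0, 1]]. *)
Let P_G (A : set (measurableTypeR R)) : measurable A ->
  pushforward P G A = density_measure mu m01 ind01 A.
Proof.
move=> mA.
pose m1 : {measure set (measurableTypeR R) -> \bar R} := pushforward P G.
pose m2 : {measure set (measurableTypeR R) -> \bar R} := density_measure mu m01 ind01.
have m2E B : measurable B -> m2 B = mu (`[0, 1] `&` B).
  by move=> mB; rewrite -[LHS]/(\int[mu]_(x in B) (\1_`[0, 1] x)%:E)%E integral_indic.
have := @measure_unique _ _ (measurableTypeR R) (@RGenInftyO.G R)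
  (fun n => `]-oo, n%:R[%classic) _ _ _ _ (m1 mG) m2.
apply => //.
- exact: RGenInftyO.measurableE.
- move=> _ _ [x ->] [y ->]; exists (Num.min x y).
  by apply/seteqP; split => z /=; rewrite !in_itv/= lt_min => /andP.
- by move=> i; exists i%:R.
- apply/seteqP; split => // x _; exists (Num.truncn `|x|).+1 => //=.
  by rewrite in_itv/= (le_lt_trans (ler_norm x))// truncnS_gt.
- move=> _ [a ->]; rewrite m2E// -[LHS]/(P (G @^-1` `]-oo, a[)).
  have [a0|a0] := leP a 0.
    rewrite (_ : G @^-1` _ = set0); last first.
      apply/seteqP; split => // t /=; rewrite in_itv/= => Gta.
      by have := lt_le_trans Gta a0; rewrite ltNge G_ge0.
    rewrite measure0 (_ : _ `&` _ = set0) ?measure0//.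
    apply/seteqP; split => // t [] /=; rewrite !in_itv/= => /andP[t0 _] ta.
    by have := lt_le_trans ta a0; rewrite ltNge t0.
  have [a1|a1] := leP a 1.
    rewrite PG ?a0// (_ : _ `&` _ = `[0, a[%classic).
      by rewrite lebesgue_measure_itv/= lte_fin a0 sube0.
    apply/seteqP; split => t /=; rewrite !in_itv/=.
      by move=> [/andP[-> _] ->].
    by move=> /andP[-> ta]; rewrite ta (ltW (lt_le_trans ta a1)).
  rewrite (_ : G @^-1` _ = setT); last first.
    by apply/seteqP; split => // t _ /=; rewrite in_itv/= (le_lt_trans (G_le1 t)).
  rewrite PT (_ : _ `&` _ = `[0, 1]%classic).
    by rewrite lebesgue_measure_itv/= lte_fin ltr01 sube0.
  apply/seteqP; split => t /=; rewrite !in_itv/=; first by case.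
  by move=> /andP[-> t1]; rewrite t1 (le_lt_trans t1).
- move=> n; rewrite (@le_lt_trans _ _ 1%E) ?ltry// P_le1//.
  by rewrite -[X in measurable X]setTI; exact: mG.
Qed.

Lemma integral_comp_density_cdf (h : R -> \bar R) :
  measurable_fun (setT : set (measurableTypeR R)) h -> (forall x, (0 <= h x)%E) ->
  (\int[mu]_t (h (G t) * (f t)%:E) = \int[mu]_(s in `[0%R, 1%R]) h s)%E.
Proof.
move=> mh h0.
have mhG : measurable_fun setT (h \o G) by exact: (measurableT_comp mh mG).
have /= <- := integral_density_measure mu mf f0 mhG (fun x => h0 (G x)).
transitivity (\int[pushforward P G]_x h x)%E.
  by rewrite ge0_integral_pushforward//.
rewrite (eq_measure_integral (density_measure mu m01 ind01)); last first.
  by move=> A mA _; exact: P_G.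
rewrite integral_density_measure// [RHS]integral_mkcond.
apply: eq_integral => x _; rewrite patchE indicE.
by case: ifPn; rewrite ?mule1 ?mule0.
Qed.

End cdf_uniform.

(** * Iterated integrals on boxes and transports of densities *)

Section box_theory.
Context (R : realType).
Local Notation mu := (@lebesgue_measure R).
Implicit Types d : nat.

Definition splitR d (x : vec R d.+1) : measurableTypeR R * vec R d :=
  (thead x, [tuple of behead x]).

Lemma splitRK d (x : vec R d.+1) : consR (splitR x) = x.
Proof. by rewrite [RHS]tuple_eta. Qed.

Lemma measurable_splitR d : measurable_fun setT (@splitR d).
Proof.
apply/measurable_fun_pairP; split; last exact: measurable_behead.
exact: measurable_tnth.
Qed.

Lemma tnth_consRS d (z : measurableTypeR R * vec R d) i :
  tnth (consR z) (lift ord0 i) = tnth z.2 i.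
Proof. by rewrite /consR tnthS. Qed.

Lemma box_consR d (D : 'I_d.+1 -> set R) (z : measurableTypeR R * vec R d) :
  box D (consR z) <-> D ord0 z.1 /\ box (fun i => D (lift ord0 i)) z.2.
Proof.
split=> [Dz|[D0 D1] i]; first split.
- by have := Dz ord0.
- by move=> i; have := Dz (lift ord0 i); rewrite tnth_consRS.
- by case: (unliftP ord0 i) => [j ->|->//]; rewrite tnth_consRS; exact: D1.
Qed.

Lemma measurable_box d (D : 'I_d -> set R) :
  (forall i, measurable (D i : set (measurableTypeR R))) -> measurable (box D).
Proof.
move=> mD; rewrite (_ : box D =
    \big[setI/setT]_(i < d) ((fun x : vec R d => tnth x i) @^-1` D i)).
  apply: bigsetI_measurable => i _; rewrite -[X in measurable X]setTI.
  exact: measurable_tnth.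
rewrite -bigcap_seq; apply/seteqP; split => x Dx i => [_|]; first exact: Dx.
by apply: Dx; exact: mem_index_enum.
Qed.

Lemma measurable_cube d : measurable (@cube R d).
Proof. by apply: measurable_box => i; exact: measurable_itv. Qed.

Lemma integral_leb0 (f : vec R 0 -> \bar R) :
  measurable_fun setT f -> (\int[leb 0]_x f x = f [tuple])%E.
Proof.
by move=> mf; rewrite integral_dirac// diracT mul1e.
Qed.

Lemma integral_lebS d (f : vec R d.+1 -> \bar R) :
  measurable_fun setT f -> (forall x, (0 <= f x)%E) ->
  (\int[leb d.+1]_x f x = \int[mu]_t \int[leb d]_y f (consR (t, y)))%E.
Proof.
move=> mf f0; have mc := @measurable_consR R d.
transitivity (\int[pushforward (mu \x leb d)%E (@consR R d)]_x f x)%E.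
  exact: eq_measure_integral.
rewrite ge0_integral_pushforward//.
rewrite fubini_tonelli1//.
  exact: measurableT_comp.
by move=> z; exact: f0.
Qed.

Lemma integral_leb_box d (D : 'I_d.+1 -> set R) (f : vec R d.+1 -> \bar R) :
  (forall i, measurable (D i : set (measurableTypeR R))) ->
  measurable_fun setT f -> (forall x, (0 <= f x)%E) ->
  (\int[leb d.+1]_(x in box D) f x =
   \int[mu]_(t in D ord0)
     \int[leb d]_(y in box (fun i => D (lift ord0 i))) f (consR (t, y)))%E.
Proof.
move=> mD mf f0; have mB := measurable_box mD.
rewrite integral_mkcond integral_lebS; last 2 first.
- by apply/(measurable_restrictT _ mB); exact: measurable_funTS.
- by move=> x; rewrite patchE; case: ifP.
rewrite [RHS]integral_mkcond; apply: eq_integral => t _; rewrite patchE.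
case: ifPn => [|]; rewrite ?inE ?notin_setE => Dt.
  rewrite [RHS]integral_mkcond; apply: eq_integral => y _; rewrite !patchE.
  congr (if _ then _ else _); apply/idP/idP; rewrite !inE => Dy.
    by move/box_consR : Dy => [].
  by apply/box_consR.
rewrite integral0_eq// => y _; rewrite patchE ifF//; apply/negbTE.
by rewrite notin_setE => /box_consR[].
Qed.

End box_theory.

Section transports.
Context (R : realType).

(** For densities with respect to [mu] and [nu], this says that [f] pushes [p] forward to [q]. The
    test functions are extended-valued and constrained on [E] only, so the third clause serves
    directly as the change of variables formula. *)
Definition transports d1 d2 (T1 : measurableType d1) (T2 : measurableType d2)
    (mu : {measure set T1 -> \bar R}) (D : set T1) (p : T1 -> R)
    (nu : {measure set T2 -> \bar R}) (E : set T2) (q : T2 -> R) (f : T1 -> T2) :=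
  [/\ measurable_fun D f, forall x, D x -> E (f x) &
      forall h : T2 -> \bar R, measurable_fun E h -> (forall y, E y -> 0 <= h y)%E ->
      (\int[mu]_(x in D) (h (f x) * (p x)%:E) = \int[nu]_(y in E) (h y * (q y)%:E))%E].

Lemma transports_comp d1 d2 d3 (T1 : measurableType d1) (T2 : measurableType d2)
    (T3 : measurableType d3) (mu : {measure set T1 -> \bar R}) D p
    (nu : {measure set T2 -> \bar R}) E q (rho : {measure set T3 -> \bar R}) F r
    (f : T1 -> T2) (g : T2 -> T3) :
  measurable E -> measurable F ->
  transports mu D p nu E q f -> transports nu E q rho F r g ->
  transports mu D p rho F r (g \o f).
Proof.
move=> mE mF [mf fDE If] [mg gEF Ig]; split.
- by apply: (measurable_comp mE _ mg mf) => _ [x Dx <-]; exact: fDE.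
- by move=> x Dx; apply/gEF/fDE.
- move=> h mh h0; rewrite -Ig// -(If (h \o g))//.
  + by apply: (measurable_comp mF _ mh mg) => _ [y Ey <-]; exact: gEF.
  + by move=> y Ey; apply/h0/gEF.
Qed.

Section two_spaces.
Context d1 d2 (T1 : measurableType d1) (T2 : measurableType d2).
Variables (mu : {measure set T1 -> \bar R}) (nu : {measure set T2 -> \bar R}).
Variables (D : set T1) (E : set T2) (p : T1 -> R) (q : T2 -> R) (f : T1 -> T2).

Lemma eq_transports p' q' : {in D, p =1 p'} -> {in E, q =1 q'} ->
  transports mu D p nu E q f -> transports mu D p' nu E q' f.
Proof.
move=> pp' qq' [mf fDE If]; split => // h mh h0.
transitivity (\int[mu]_(x in D) (h (f x) * (p x)%:E))%E.
  by apply: eq_integral => x Dx; rewrite pp'.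
by rewrite If//; apply: eq_integral => y Ey; rewrite qq'.
Qed.

Hypotheses (mD : measurable D) (mE : measurable E).
Hypotheses (mp : measurable_fun D p) (p0 : forall x, D x -> 0 <= p x).
Hypothesis fpq : transports mu D p nu E q f.

Variable g : T2 -> T1.
Hypotheses (mg : measurable_fun E g) (gED : forall y, E y -> D (g y)).
Hypothesis gf : {ae mu, forall x, D x -> g (f x) = x}.

Let measurable_g d3 (T3 : measurableType d3) (h : T1 -> T3) :
  measurable_fun D h -> measurable_fun E (h \o g).
Proof.
by move=> mh; apply: (measurable_comp mD _ mh mg) => _ [y Ey <-]; exact: gED.
Qed.

Let measurable_f d3 (T3 : measurableType d3) (h : T2 -> T3) :
  measurable_fun E h -> measurable_fun D (h \o f).
Proof.
case: fpq => mf fDE _.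
by move=> mh; apply: (measurable_comp mE _ mh mf) => _ [y Ey <-]; exact: fDE.
Qed.

(** Use the identity for [f] with the test function [h \o g]: almost everywhere [h (g (f x))] is
    [h x]. *)
Lemma transports_left_inverse : transports nu E q mu D p g.
Proof.
have [mf fDE If] := fpq; split => // h mh h0.
rewrite -(If (h \o g)); [|exact: measurable_g|by move=> y Ey; exact/h0/gED].
apply: ge0_ae_eq_integral => //.
- by apply: emeasurable_funM; [exact/measurable_f/measurable_g|exact/measurable_EFinP].
- by apply: emeasurable_funM => //; exact/measurable_EFinP.
- by move=> x Dx; rewrite mule_ge0// ?lee_fin ?p0//; exact/h0/gED/fDE.
- by move=> x Dx; rewrite mule_ge0// ?lee_fin ?p0//; exact/h0.
- by apply: filterS gf => x gfx Dx /=; rewrite gfx.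
Qed.

(** The test function [h * (r \o g)] moves the weight from the source to the target, because
    [r (g (f x)) = r x] almost everywhere. This creates the compositions with [Tbar_inv] in
    [pihat]. *)
Lemma transports_reweight (r : T1 -> R) :
  measurable_fun D r -> (forall x, D x -> 0 <= r x) ->
  transports mu D (fun x => r x * p x) nu E (fun y => r (g y) * q y) f.
Proof.
have [mf fDE If] := fpq; move=> mr r0; split => // h mh h0.
pose k y := (h y * (r (g y))%:E)%E.
have mk : measurable_fun E k.
  by apply: emeasurable_funM => //; apply/measurable_EFinP; exact: measurable_g.
have k0 y : E y -> (0 <= k y)%E.
  by move=> Ey; rewrite mule_ge0 ?h0// lee_fin; exact/r0/gED.
transitivity (\int[nu]_(y in E) (k y * (q y)%:E))%E; last first.
  by apply: eq_integral => y _; rewrite EFinM muleA.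
rewrite -If//; apply: ge0_ae_eq_integral => //.
- apply: emeasurable_funM; first exact: measurable_f.
  by apply/measurable_EFinP; exact: measurable_funM.
- by apply: emeasurable_funM; [exact: measurable_f|exact/measurable_EFinP].
- by move=> x Dx; rewrite mule_ge0 ?lee_fin ?mulr_ge0 ?p0 ?r0//; exact/h0/fDE.
- by move=> x Dx; rewrite mule_ge0 ?lee_fin ?p0//; exact/k0/fDE.
- by apply: filterS gf => x gfx Dx; rewrite /k gfx// EFinM muleA.
Qed.

End two_spaces.

End transports.

Section density_cdf.
Context (R : realType).
Local Notation mu := (@lebesgue_measure R).
Variables (D : set (measurableTypeR R)) (f : R -> R).
Hypotheses (mD : measurable D) (mf : measurable_fun D f).
Hypothesis f0 : forall t, D t -> 0 <= f t.

Let mDt t : measurable (D `&` `]-oo, t] : set (measurableTypeR R)).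
Proof. exact: measurableI. Qed.

Let cdf_le1 t : (\int[mu]_(s in D) (f s)%:E <= 1)%E ->
  (\int[mu]_(s in D `&` `]-oo, t]) (f s)%:E <= 1)%E.
Proof.
by apply: le_trans; apply: ge0_subset_integral => //; exact/measurable_EFinP.
Qed.

Let cdf_ge0 t : (0 <= \int[mu]_(s in D `&` `]-oo, t]) (f s)%:E)%E.
Proof. by apply: integral_ge0 => s [Ds _]; rewrite lee_fin f0. Qed.

(** The bound on the mass is an inequality so that it also covers conditional densities on
    degenerate fibres, where their integral is 0. *)
Lemma density_cdf_itv01 t : (\int[mu]_(s in D) (f s)%:E <= 1)%E ->
  `[0, 1]%classic (density_cdf D f t).
Proof.
move=> f1; rewrite /= in_itv/= /density_cdf /Rintegral fine_ge0//= -lee_fin.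
by rewrite fineK ?cdf_le1// fin_numElt (lt_le_trans (ltNyr 0%R) (cdf_ge0 t))/=
  (le_lt_trans (cdf_le1 t f1))// ltry.
Qed.

Lemma transports_density_cdf : (\int[mu]_(s in D) (f s)%:E = 1)%E ->
  transports mu D f mu `[0, 1]%classic (fun=> 1) (density_cdf D f).
Proof.
move=> f1.
have cdf_fin t : (\int[mu]_(s in D `&` `]-oo, t]) (f s)%:E \is a fin_num)%E.
  rewrite fin_numElt (lt_le_trans (ltNyr 0%R) (cdf_ge0 t))/=.
  by rewrite (le_lt_trans (cdf_le1 _ _))// ?f1 ?ltry.
split.
- apply: measurable_funTS; apply: nondecreasing_measurable => // s t st.
  apply: fine_le => //; apply: ge0_subset_integral => //.
  + by apply/measurable_EFinP; apply: measurable_funS mf.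
  + by move=> x [Dx _]; rewrite lee_fin f0.
  + by apply: setIS; exact: subset_itvl.
- by move=> t _; apply: density_cdf_itv01; rewrite f1.
move=> h mh h0.
(* Extension by zero leaves the distribution function unchanged and reduces the claim to a density
   on the whole line. *)
have mfD : measurable_fun setT (f \_ D : measurableTypeR R -> R).
  exact/(measurable_restrictT _ mD).
have fD0 x : 0 <= (f \_ D) x by rewrite patchE; case: ifPn => // /[!inE] /f0.
have fDE : EFin \o (f \_ D) = (EFin \o f) \_ D.
  by apply/funext => x /=; rewrite !patchE; case: ifP.
have fD1 : (\int[mu]_x ((f \_ D) x)%:E = 1)%E.
  by rewrite -f1 [RHS]integral_mkcond -fDE.
have cdfE t : density_cdf D f t = density_cdf setT (f \_ D) t.
  rewrite /density_cdf /Rintegral setTI; congr fine.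
  rewrite integral_mkcond [RHS]integral_mkcond; apply: eq_integral => s _.
  rewrite !patchE in_setI; case: (s \in D) => //=.
  by case: ifP.
have mI : measurable (`[0, 1]%classic : set (measurableTypeR R)) by [].
rewrite [RHS](_ : _ = \int[mu]_(y in `[0%R, 1%R]) (h \_ `[0%R, 1%R]) y)%E; last first.
  by apply: eq_integral => y yI; rewrite mule1 patchE yI.
rewrite -(integral_comp_density_cdf mfD fD0 fD1); last 2 first.
- exact/(measurable_restrictT _ mI).
- by move=> y; rewrite patchE; case: ifPn => // /[!inE] /h0.
rewrite integral_mkcond; apply: eq_integral => t _; rewrite !patchE -cdfE.
case: ifPn => tD; last by rewrite mule0.
by rewrite ifT// inE; apply: density_cdf_itv01; rewrite f1.
Qed.

End density_cdf.

(** * The Rosenblatt map *)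

Section measurable_compositions.
Context (R : realType) disp (T : measurableType disp).

Lemma measurable_fun_fine (f : T -> \bar R) :
  measurable_fun setT f -> measurable_fun setT (fun x => fine (f x)).
Proof. exact: measurableT_comp. Qed.

Lemma measurable_fun_inv (D : set T) (f : T -> R) :
  measurable_fun D f -> measurable_fun D (fun x => (f x)^-1).
Proof.
suff mV : measurable_fun setT (fun x : measurableTypeR R => x^-1 : R).
  by move=> mf; exact: (measurableT_comp mV mf).
(* The inverse is discontinuous at 0, where its value is 0 by convention; it is continuous on the
   open complement. *)
rewrite (_ : (fun x => _) =
    fun x : measurableTypeR R => if x == 0 then 0 else x^-1 : R); last first.
  by apply/funext => x; case: eqVneq => // ->; rewrite invr0.
apply: measurable_fun_if => //.
  exact: measurable_fun_eqr.
rewrite setTI; apply: open_continuous_measurable_fun.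
  rewrite (_ : _ @^-1` _ = ([set~ 0] : set R)).
    by apply/closed_openC/accessible_closed_set1/hausdorff_accessible/Rhausdorff.
  by apply/seteqP; split => x /= => [/negbT/eqP|/eqP/negbTE].
by move=> x; rewrite inE/= => /negbT x0; exact: inv_continuous.
Qed.

End measurable_compositions.

Lemma measurable_integral_section d1 d2 (T1 : measurableType d1)
    (T2 : measurableType d2) (R : realType)
    (m2 : {sigma_finite_measure set T2 -> \bar R}) (B : set T2) (F : T1 * T2 -> \bar R) :
  measurable B -> measurable_fun setT F -> (forall z, (0 <= F z)%E) ->
  measurable_fun setT (fun x => \int[m2]_(y in B) F (x, y))%E.
Proof.
(* As an indicator factor, [B] is absorbed into the integrand and Tonelli applies on the whole
   product. *)
move=> mB mF F0; pose F' z : \bar R := (F z * (\1_B z.2)%:E)%E.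
have mF' : measurable_fun setT F'.
  apply: emeasurable_funM => //.
  by apply/measurable_EFinP; exact: measurableT_comp.
have F'0 z : (0 <= F' z)%E by rewrite mule_ge0// lee_fin indicE.
have := measurable_fun_fubini_tonelli_F (m2 := m2) F' mF' F'0.
apply: eq_measurable_fun => x _; rewrite /fubini_F [RHS]integral_mkcond.
apply: eq_integral => y _; rewrite /F'/= patchE indicE.
by case: ifPn; rewrite ?mule1 ?mule0.
Qed.

Lemma ae_imply d (T : measurableType d) (R : realType) (mu : {measure set T -> \bar R})
    (P Q : T -> Prop) :
  (forall x, P x -> Q x) -> {ae mu, forall x, P x} -> {ae mu, forall x, Q x}.
Proof. by move=> PQ; apply: filterS. Qed.

Section rosenblatt.
Context (R : realType).
Local Notation mu := (@lebesgue_measure R).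
Local Notation tailD D := (fun i => D (lift ord0 i)).

(** Tonelli's theorem speaks of this extended-valued marginal; [marginal1] is its [fine] part and
    takes the value 0 where it is infinite. *)
Definition marginal1e d (D : 'I_d.+1 -> set R) (p : vec R d.+1 -> R) (t : R) : \bar R :=
  (\int[leb d]_(y in box (tailD D)) (p (consR (t, y)))%:E)%E.

Lemma marginal1E d (D : 'I_d.+1 -> set R) p t : marginal1 D p t = fine (marginal1e D p t).
Proof. by []. Qed.

Section measurability.
Context d (D : 'I_d.+1 -> set R) disp (S : measurableType disp).
Variable p : S -> vec R d.+1 -> R.
Hypotheses (mD : forall i, measurable (D i : set (measurableTypeR R)))
  (mp : measurable_fun setT (fun z : S * vec R d.+1 => p z.1 z.2))
  (p0 : forall s x, 0 <= p s x).

Lemma measurable_param_consR :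
  measurable_fun setT (fun z : (S * measurableTypeR R) * vec R d =>
    p z.1.1 (consR (z.1.2, z.2))).
Proof.
apply: (measurableT_comp mp (f := fun z => p z.1 z.2)
  (g := fun z : (S * measurableTypeR R) * vec R d => (z.1.1, consR (z.1.2, z.2)))).
apply: measurable_fun_pair => /=.
  exact: (measurableT_comp measurable_fst measurable_fst).
apply: (measurableT_comp (@measurable_consR R d)).
apply: measurable_fun_pair => //.
exact: (measurableT_comp measurable_snd measurable_fst).
Qed.

Lemma measurable_param_marginal1e :
  measurable_fun setT (fun z : S * measurableTypeR R => marginal1e D (p z.1) z.2).
Proof.
have mB : measurable (box (tailD D)) by exact: measurable_box.
apply: (measurable_integral_section (leb d)
  (F := fun z => (p z.1.1 (consR (z.1.2, z.2)))%:E)) => //.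
  by apply/measurable_EFinP; exact: measurable_param_consR.
by move=> z; rewrite lee_fin p0.
Qed.

Lemma measurable_param_marginal1 :
  measurable_fun setT (fun z : S * measurableTypeR R => marginal1 D (p z.1) z.2).
Proof. exact: (measurable_fun_fine measurable_param_marginal1e). Qed.

Lemma marginal1_ge0 s t : 0 <= marginal1 D (p s) t.
Proof. by rewrite fine_ge0// integral_ge0// => y _; rewrite lee_fin. Qed.

Lemma measurable_param_conditional1 :
  measurable_fun setT (fun z : (S * measurableTypeR R) * vec R d =>
    conditional1 D (p z.1.1) z.1.2 z.2).
Proof.
apply: measurable_funM; first exact: measurable_param_consR.
apply: measurable_fun_inv.
exact: (measurableT_comp (f := fun z => marginal1 D (p z.1) z.2)
  measurable_param_marginal1 measurable_fst).
Qed.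

Lemma conditional1_ge0 s t y : 0 <= conditional1 D (p s) t y.
Proof. by rewrite divr_ge0// marginal1_ge0. Qed.

End measurability.

Lemma measurable_param_density_cdf disp (S : measurableType disp)
    (D : set (measurableTypeR R)) (f : S -> R -> R) :
  measurable D ->
  measurable_fun setT (fun z : S * measurableTypeR R => f z.1 z.2) ->
  (forall s t, 0 <= f s t) ->
  measurable_fun setT (fun z : S * measurableTypeR R => density_cdf D (f z.1) z.2).
Proof.
move=> mD mf f0.
(* The domain of integration varies with [t]. Turning the condition [s <= t] into a jointly
   measurable factor leaves a fixed domain, and Tonelli gives measurability in both variables. *)
pose I (z : (S * measurableTypeR R) * measurableTypeR R) : bool := z.2 <= z.1.2.
pose F (z : (S * measurableTypeR R) * measurableTypeR R) : \bar R :=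
  ((f z.1.1 z.2)%:E * ((\1_D z.2)%:E * ((I z)%:R)%:E))%E.
have mF : measurable_fun setT F.
  apply: emeasurable_funM.
    apply/measurable_EFinP.
    apply: (measurableT_comp mf (f := fun z => f z.1 z.2)
      (g := fun z : (S * measurableTypeR R) * measurableTypeR R => (z.1.1, z.2))).
    apply: measurable_fun_pair => //=.
    exact: (measurableT_comp measurable_fst measurable_fst).
  apply: emeasurable_funM.
    by apply/measurable_EFinP; exact: measurableT_comp.
  apply/measurable_EFinP.
  have mI : measurable_fun setT I.
    apply: measurable_fun_ler => //.
    exact: (measurableT_comp measurable_snd measurable_fst).
  rewrite (_ : (fun z => _) = fun z => if I z then 1 else 0); last first.
    by apply/funext => z; case: (I z).
  exact: measurable_fun_if.
have F0 z : (0 <= F z)%E.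
  by rewrite mule_ge0 ?lee_fin// mule_ge0// lee_fin ?indicE// ler0n.
rewrite /density_cdf /Rintegral.
apply: measurable_fun_fine.
have := measurable_fun_fubini_tonelli_F (m2 := mu) F mF F0.
apply: eq_measurable_fun => z _; rewrite /fubini_F [RHS]integral_mkcond.
apply: eq_integral => y _; rewrite /F/= patchE indicE in_setI /I/=.
rewrite [X in _ && X](_ : _ = (y <= z.2)); last first.
  by apply/idP/idP; rewrite inE/= in_itv.
by case: (y \in D); case: (y <= z.2); rewrite /= ?mule1 ?mule0.
Qed.

(* The parameter makes the induction go through: the conditional density of
   (x_2, ..., x_d) depends on x_1. *)
Lemma measurable_param_rosenblatt d (D : 'I_d -> set R) disp (S : measurableType disp)
    (p : S -> vec R d -> R) :
  (forall i, measurable (D i : set (measurableTypeR R))) ->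
  measurable_fun setT (fun z : S * vec R d => p z.1 z.2) ->
  (forall s x, 0 <= p s x) ->
  measurable_fun setT (fun z : S * vec R d => rosenblatt D (p z.1) z.2).
Proof.
elim: d D disp S p => [|d IHd] D disp S p mD mp p0; first exact: measurable_snd.
have msplit : measurable_fun setT (fun z : S * vec R d.+1 => splitR z.2).
  exact: (measurableT_comp (@measurable_splitR R d) measurable_snd).
have mhead : measurable_fun setT (fun z : S * vec R d.+1 => (z.1, thead z.2)).
  apply: measurable_fun_pair => //=.
  exact: (measurableT_comp (f := fst) measurable_fst msplit).
apply: (measurableT_comp (@measurable_consR R d)).
apply: measurable_fun_pair => /=.
  apply: (measurableT_comp _ mhead
    (f := fun z : S * measurableTypeR R => density_cdf (D ord0) (marginal1 D (p z.1)) z.2)).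
  apply: (measurable_param_density_cdf (f := fun s => marginal1 D (p s))) => //.
    exact: measurable_param_marginal1.
  by move=> s t; exact: marginal1_ge0.
have mtail : measurable_fun setT
    (fun z : S * vec R d.+1 => ((z.1, thead z.2), [tuple of behead z.2])).
  apply: measurable_fun_pair => //=.
  exact: (measurableT_comp (f := snd) measurable_snd msplit).
apply: (measurableT_comp _ mtail
  (f := fun z : (S * measurableTypeR R) * vec R d =>
     rosenblatt (tailD D) (conditional1 D (p z.1.1) z.1.2) z.2)).
apply: (IHd _ _ _ (fun s : S * measurableTypeR R => conditional1 D (p s.1) s.2)) => //.
- exact: measurable_param_conditional1.
- by move=> s y; exact: conditional1_ge0.
Qed.

(** All integrals in the recursion run over parts of the box. Hence a density may be replaced by its
    extension by zero, and the conditional of a product density by the product of its remaining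
    factors. *)
Lemma eq_rosenblatt d (D : 'I_d -> set R) p p' x :
  (forall y, box D y -> p y = p' y) -> box D x -> rosenblatt D p x = rosenblatt D p' x.
Proof.
elim: d D p p' x => [//|d IHd] D p p' x pp' Dx /=.
have [Dx0 Dx1] : D ord0 (thead x) /\ box (tailD D) [tuple of behead x].
  by move: Dx; rewrite -{1}(splitRK x) => /box_consR.
have mm t : D ord0 t -> marginal1 D p t = marginal1 D p' t.
  move=> Dt; congr fine; apply: eq_integral => y /[!inE] Dy; congr EFin.
  by apply: pp'; apply/box_consR.
have -> : density_cdf (D ord0) (marginal1 D p) (thead x) =
    density_cdf (D ord0) (marginal1 D p') (thead x).
  by congr fine; apply: eq_integral => t /[!inE] -[Dt _]; rewrite mm.
congr consR; congr pair; apply: IHd => // y Dy; rewrite /conditional1 mm// pp'//.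
by apply/box_consR.
Qed.

Section density.
Context d (D : 'I_d.+1 -> set R) (p : vec R d.+1 -> R).
Hypotheses (mD : forall i, measurable (D i : set (measurableTypeR R)))
  (mp : measurable_fun setT p) (p0 : forall x, 0 <= p x).

Let mpc : measurable_fun setT (fun z : measurableTypeR R * vec R d => p (consR z)).
Proof. exact: (measurableT_comp mp (@measurable_consR R d)). Qed.

Let mpt t : measurable_fun setT (fun y : vec R d => p (consR (t, y))).
Proof. exact: (measurable_fun_pair2 t mpc). Qed.

Lemma marginal1e_ge0 t : (0 <= marginal1e D p t)%E.
Proof. by apply: integral_ge0 => y _; rewrite lee_fin. Qed.

Lemma measurable_marginal1e : measurable_fun setT (marginal1e D p : measurableTypeR R -> _).
Proof.
have := @measurable_param_marginal1e _ D _ unit (fun=> p) mD _ (fun=> p0).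
move/(_ (measurableT_comp mp measurable_snd)) => m1.
exact: (measurable_fun_pair2 tt m1).
Qed.

Lemma measurable_conditional1 t : measurable_fun setT (conditional1 D p t).
Proof. by apply: measurable_funM => //; exact: mpt. Qed.

Lemma integral_conditional1 t :
  (\int[leb d]_(y in box (tailD D)) (conditional1 D p t y)%:E =
   ((marginal1 D p t)^-1)%:E * marginal1e D p t)%E.
Proof.
rewrite /conditional1; under eq_integral do rewrite mulrC EFinM.
rewrite ge0_integralZl//.
- exact: measurable_box.
- by apply/measurable_EFinP; apply: measurable_funTS; exact: mpt.
- by move=> y _; rewrite lee_fin.
- by rewrite lee_fin invr_ge0 fine_ge0// marginal1e_ge0.
Qed.

(** The value is 1 when the marginal is positive and finite. Otherwise [marginal1] is 0, so is its
    inverse, and the product is 0 even against [+oo]. *)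
Lemma integral_conditional1_le1 t :
  (\int[leb d]_(y in box (tailD D)) (conditional1 D p t y)%:E <= 1)%E.
Proof.
rewrite integral_conditional1 marginal1E.
case: (marginal1e D p t) => [m| |] /=; rewrite ?invr0 ?mul0e//.
by have [->|m0] := eqVneq m 0; rewrite ?invr0 ?mul0e// -EFinM mulVf.
Qed.

Lemma integral_marginal1e :
  (\int[mu]_(t in D ord0) marginal1e D p t = \int[leb d.+1]_(x in box D) (p x)%:E)%E.
Proof.
rewrite integral_leb_box//; first exact/measurable_EFinP.
Qed.

Lemma integral_marginal1_le :
  (\int[mu]_(t in D ord0) (marginal1 D p t)%:E <= \int[leb d.+1]_(x in box D) (p x)%:E)%E.
Proof.
rewrite -integral_marginal1e; apply: ge0_le_integral => //.
- by move=> t _; rewrite lee_fin fine_ge0// marginal1e_ge0.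
- apply/measurable_EFinP; apply: measurable_funTS.
  exact: (measurable_fun_fine measurable_marginal1e).
- by apply: measurable_funTS; exact: measurable_marginal1e.
- move=> t _; rewrite marginal1E; have := marginal1e_ge0 t.
  by case: (marginal1e D p t) => //= _; rewrite leey.
Qed.

(** By Tonelli the marginal is integrable, hence finite almost everywhere. *)
Lemma ae_marginal1 : (\int[leb d.+1]_(x in box D) (p x)%:E < +oo)%E ->
  {ae mu, forall t, D ord0 t -> marginal1e D p t = (marginal1 D p t)%:E}.
Proof.
rewrite -integral_marginal1e => foo.
have : mu.-integrable (D ord0) (marginal1e D p).
  apply/integrableP; split; first by apply: measurable_funTS; exact: measurable_marginal1e.
  by under eq_integral do rewrite gee0_abs ?marginal1e_ge0//.
move=> /(integrable_ae (mD ord0)); apply: filterS => t fin Dt.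
by rewrite marginal1E fineK// fin.
Qed.

End density.

(** This holds at every point, degenerate fibres included. Mass at most 1 is inherited by all
    conditional densities, mass exactly 1 is not. *)
Lemma rosenblatt_cube d (D : 'I_d -> set R) (p : vec R d -> R) x :
  (forall i, measurable (D i : set (measurableTypeR R))) ->
  measurable_fun setT p -> (forall x, 0 <= p x) ->
  (\int[leb d]_(x in box D) (p x)%:E <= 1)%E -> cube (rosenblatt D p x).
Proof.
elim: d D p x => [|d IHd] D p x mD mp p0 p1; first by case.
apply/box_consR; split => /=.
  apply: density_cdf_itv01 => //.
  - apply: measurable_funTS.
    exact: (measurable_fun_fine (measurable_marginal1e mD mp p0)).
  - by move=> t _; rewrite fine_ge0// marginal1e_ge0.
  - by rewrite (le_trans (integral_marginal1_le mD mp p0)).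
apply: IHd => //.
- exact: measurable_conditional1.
- by move=> y; rewrite divr_ge0// fine_ge0// marginal1e_ge0.
- exact: integral_conditional1_le1.
Qed.

Lemma measurable_rosenblatt d (D : 'I_d -> set R) (p : vec R d -> R) :
  (forall i, measurable (D i : set (measurableTypeR R))) ->
  measurable_fun setT p -> (forall x, 0 <= p x) ->
  measurable_fun setT (rosenblatt D p).
Proof.
move=> mD mp p0.
have := @measurable_param_rosenblatt _ D _ unit (fun=> p) mD _ (fun=> p0).
move/(_ (measurableT_comp mp measurable_snd)) => mr.
exact: (measurable_fun_pair2 tt mr).
Qed.

Lemma box0E (D : 'I_0 -> set R) : box D = setT.
Proof. by apply/seteqP; split => // x _ []. Qed.

(** On the fibre over [t], the induction hypothesis for the conditional density turns the inner
    integral into the marginal at [t] times [H] at the first component of the map. The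
    one-dimensional transform then integrates [H] over the unit interval. *)
Lemma integral_leb_rosenblatt d (D : 'I_d -> set R) (p : vec R d -> R)
    (h : vec R d -> \bar R) :
  (forall i, measurable (D i : set (measurableTypeR R))) ->
  measurable_fun setT p -> (forall x, 0 <= p x) ->
  (\int[leb d]_(x in box D) (p x)%:E = 1)%E ->
  measurable_fun setT h -> (forall x, (0 <= h x)%E) ->
  (\int[leb d]_(x in box D) (h (rosenblatt D p x) * (p x)%:E) =
   \int[leb d]_(x in @cube R d) h x)%E.
Proof.
elim: d D p h => [|d IHd] D p h mD mp p0 p1 mh h0.
  have mpE : measurable_fun setT (EFin \o p) by exact/measurable_EFinP.
  move: p1; rewrite /cube !box0E integral_leb0// => p1.
  rewrite integral_leb0/=; last exact: emeasurable_funM.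
  by rewrite integral_leb0// p1 mule1.
have mr := measurable_rosenblatt mD mp p0.
have mhc : measurable_fun setT (fun z : measurableTypeR R * vec R d => h (consR z)).
  exact: (measurableT_comp mh (@measurable_consR R d)).
have mpc : measurable_fun setT (fun z : measurableTypeR R * vec R d => p (consR z)).
  exact: (measurableT_comp mp (@measurable_consR R d)).
have m1e0 := marginal1e_ge0 D p0.
have mm1e := measurable_marginal1e mD mp p0.
pose H t : \bar R := (\int[leb d]_(y in @cube R d) h (consR (t, y)))%E.
have mH : measurable_fun (setT : set (measurableTypeR R)) H.
  apply: (measurable_integral_section (leb d) (F := h \o @consR R d)) => //.
    exact: measurable_cube.
  by move=> z; exact: h0.
have H0 t : (0 <= H t)%E by apply: integral_ge0.
rewrite [RHS]integral_leb_box//.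
rewrite -[RHS]/(\int[mu]_(t in `[0%R, 1%R]) H t)%E.
have m1 : (\int[mu]_(t in D ord0) marginal1e D p t = 1)%E.
  by rewrite integral_marginal1e.
have ae1 : {ae mu, forall t, D ord0 t -> marginal1e D p t = (marginal1 D p t)%:E}.
  by apply: ae_marginal1 => //; rewrite p1 ltry.
have mm1 : measurable_fun (D ord0) (marginal1 D p : measurableTypeR R -> R).
  by apply: measurable_funTS; exact: measurable_fun_fine.
have m10 t : 0 <= marginal1 D p t by exact: fine_ge0 (m1e0 t).
(* [marginal1] has mass 1 because it agrees with the extended marginal almost everywhere. *)
have [|mc c01 cE] := @transports_density_cdf R (D ord0) (marginal1 D p)
  (mD ord0) mm1 (fun t _ => m10 t).
  rewrite -m1; apply: ge0_ae_eq_integral => //.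
  - exact/measurable_EFinP.
  - exact: measurable_funTS.
  - by move=> t _; rewrite lee_fin.
  - by apply: ae_imply ae1 => t + Dt => ->.
transitivity (\int[mu]_(t in `[0%R, 1%R]) (H t * 1%:E))%E; last first.
  by apply: eq_integral => t _; rewrite mule1.
rewrite -cE//; last exact: measurable_funTS.
rewrite integral_leb_box//; last 2 first.
- apply: emeasurable_funM; last exact/measurable_EFinP.
  exact: measurableT_comp.
- by move=> x; rewrite mule_ge0// lee_fin.
pose K (z : measurableTypeR R * vec R d) : \bar R :=
  (h (rosenblatt D p (consR z)) * (p (consR z))%:E)%E.
have mK : measurable_fun setT K.
  apply: emeasurable_funM; last exact/measurable_EFinP.
  exact: (measurableT_comp mh (measurableT_comp mr (@measurable_consR R d))).
have mB : measurable (box (tailD D)) by exact: measurable_box.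
apply: ge0_ae_eq_integral => //.
- apply: measurable_funTS.
  apply: (measurable_integral_section (leb d) (F := K)) => // z.
  by rewrite mule_ge0// lee_fin.
- apply: emeasurable_funM; last exact/measurable_EFinP.
  exact: (measurableT_comp mH mc).
- by move=> t _; apply: integral_ge0 => y _; rewrite mule_ge0// lee_fin.
- by move=> t _; rewrite mule_ge0// lee_fin.
apply: ae_imply ae1 => t m1t Dt.
have {}m1t := m1t Dt.
(* If the marginal vanishes at t then conditional1 is 0 there (x / 0 = 0), so it is
   not a density, but p itself vanishes almost everywhere on the fibre. *)
have [mt0|mt0] := eqVneq (marginal1 D p t) 0.
  rewrite mt0 mule0.
  have mpt : measurable_fun (box (tailD D)) (fun y : vec R d => (p (consR (t, y)))%:E).
    apply/measurable_EFinP; apply: measurable_funTS.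
    exact: (measurable_fun_pair2 t mpc).
  have : (\int[leb d]_(y in box (tailD D)) `|(p (consR (t, y)))%:E| = 0)%E.
    under eq_integral do rewrite gee0_abs ?lee_fin//.
    by rewrite -[LHS]/(marginal1e D p t) m1t mt0.
  move/(ae_eq_integral_abs _ mB mpt) => aep.
  rewrite (_ : 0%E = \int[leb d]_(y in box (tailD D)) (0 : \bar R))%E;
    last by rewrite integral0.
  apply: ge0_ae_eq_integral => //.
  + apply: measurable_funTS; exact: (measurable_fun_pair2 t mK).
  + by move=> y _; rewrite mule_ge0// lee_fin.
  + by apply: ae_imply aep => y py Dy; rewrite py// mule0.
have pE y : p (consR (t, y)) = marginal1 D p t * conditional1 D p t y.
  by rewrite /conditional1 mulrCA divff// mulr1.
have c0 y : 0 <= conditional1 D p t y by rewrite divr_ge0.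
have mcond := measurable_conditional1 D mp t.
have mht : measurable_fun setT (fun y : vec R d =>
    h (consR (density_cdf (D ord0) (marginal1 D p) t, y))).
  exact: (measurable_fun_pair2 _ mhc).
(* Here the marginal is finite and nonzero, so the conditional density has mass 1, as the induction
   hypothesis demands. *)
rewrite /H muleC -(IHd (tailD D) (conditional1 D p t))//; last first.
  by rewrite integral_conditional1// m1t -EFinM mulVf.
rewrite -ge0_integralZl//.
- apply: eq_integral => y _; rewrite pE EFinM muleCA/=.
  by congr (_ * (h (consR (_, rosenblatt _ _ _)) * _))%E; exact: val_inj.
- apply: measurable_funTS; apply: emeasurable_funM; last exact/measurable_EFinP.
  exact: (measurableT_comp mht (measurable_rosenblatt _ mcond c0)).
- by move=> y _; rewrite mule_ge0// lee_fin.
- by rewrite lee_fin.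
Qed.

Lemma transports_rosenblatt d (D : 'I_d -> set R) (p : vec R d -> R) :
  (forall i, measurable (D i : set (measurableTypeR R))) ->
  measurable_fun (box D) p -> (forall x, box D x -> 0 <= p x) ->
  (\int[leb d]_(x in box D) (p x)%:E = 1)%E ->
  transports (leb d) (box D) p (leb d) (@cube R d) (fun=> 1) (rosenblatt D p).
Proof.
move=> mD mp p0 p1; have mB := measurable_box mD; have mC := @measurable_cube R d.
(* The preceding lemmas need a density that is measurable and nonnegative on the whole space. *)
pose p' := p \_ (box D).
have p'E x : box D x -> p x = p' x by move=> Dx; rewrite /p' patchE ifT// inE.
have mp' : measurable_fun setT p' by exact/(measurable_restrictT _ mB).
have p'0 x : 0 <= p' x by rewrite /p' patchE; case: ifPn => // /[!inE] /p0.
have p'1 : (\int[leb d]_(x in box D) (p' x)%:E = 1)%E.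
  by rewrite -p1; apply: eq_integral => x /[!inE] /p'E ->.
have rE x : box D x -> rosenblatt D p x = rosenblatt D p' x.
  exact: eq_rosenblatt.
have rC x : box D x -> cube (rosenblatt D p x).
  by move=> Dx; rewrite rE//; apply: rosenblatt_cube; rewrite ?p'1.
split => //.
  apply: (eq_measurable_fun (rosenblatt D p')); first by move=> x /[!inE] /rE.
  by apply: measurable_funTS; exact: measurable_rosenblatt.
move=> h mh h0.
transitivity (\int[leb d]_(x in box D)
    ((h \_ (@cube R d)) (rosenblatt D p' x) * (p' x)%:E))%E.
  apply: eq_integral => x /[!inE] Dx; rewrite -rE// -p'E// patchE ifT// inE.
  exact: rC.
rewrite integral_leb_rosenblatt//.
- by apply: eq_integral => x xC; rewrite patchE xC mule1.
- exact/(measurable_restrictT _ mC).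
- by move=> x; rewrite patchE; case: ifPn => // /[!inE] /h0.
Qed.

End rosenblatt.

(** * Product densities and the reference map *)

Section product_densities.
Context (R : realType).
Local Notation mu := (@lebesgue_measure R).
Local Notation tailD D := (fun i => D (lift ord0 i)).

Lemma prodf_consR d (f : 'I_d.+1 -> R -> R) (z : measurableTypeR R * vec R d) :
  prodf f (consR z) = f ord0 z.1 * prodf (fun i => f (lift ord0 i)) z.2.
Proof.
rewrite /prodf big_ord_recl; congr (_ * _).
by apply: eq_bigr => i _; rewrite tnth_consRS.
Qed.

Lemma measurable_prodf d (D : 'I_d -> set R) (f : 'I_d -> R -> R) :
  (forall i, measurable (D i : set (measurableTypeR R))) ->
  (forall i, measurable_fun (D i : set (measurableTypeR R)) (f i)) ->
  measurable_fun (box D) (prodf f).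
Proof.
move=> mD mf; apply: measurable_prod => i _.
apply: (measurable_comp (mD i) _ (mf i)).
  by move=> _ [x Dx <-]; exact: Dx.
by apply: measurable_funTS; exact: measurable_tnth.
Qed.

Lemma prodf_gt0 d (D : 'I_d -> set R) (f : 'I_d -> R -> R) :
  (forall i t, D i t -> 0 < f i t) -> forall x, box D x -> 0 < prodf f x.
Proof. by move=> f0 x Dx; apply: prodr_gt0 => i _; apply: f0; exact: Dx. Qed.

(** This is [refmap] with [D] and [f] in place of record fields, so that induction on the dimension
    can pass to the tails. *)
Definition cdf_map d (D : 'I_d -> set R) (f : 'I_d -> R -> R) (u : vec R d) : vec R d :=
  [tuple density_cdf (D i) (f i) (tnth u i) | i < d].

Lemma integral_prodf d (D : 'I_d -> set R) (f : 'I_d -> R -> R) :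
  (forall i, measurable (D i : set (measurableTypeR R))) ->
  product_density D f -> (\int[leb d]_(x in box D) (prodf f x)%:E = 1)%E.
Proof.
elim: d D f => [|d IHd] D f mD [mf f0 f1].
  rewrite box0E integral_leb0; last first.
    by apply/measurable_EFinP; rewrite -(box0E D); exact: measurable_prodf.
  by rewrite /prodf big_ord0.
have mB := measurable_box mD; have mp := measurable_prodf mD mf.
have pf1 : product_density (tailD D) (fun i => f (lift ord0 i)).
  by split => // i t; exact: f0.
have p0 := prodf_gt0 (D := tailD D) (fun i => f0 (lift ord0 i)).
have mpt : measurable_fun (box (tailD D)) (prodf (fun i => f (lift ord0 i))).
  by apply: measurable_prodf => i; [exact: mD|exact: mf].
rewrite (_ : \int[leb d.+1]_(x in box D) (prodf f x)%:E =
    \int[leb d.+1]_(x in box D) ((EFin \o prodf f) \_ (box D)) x)%E; last first.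
  by apply: eq_integral => x xD; rewrite patchE xD.
rewrite integral_leb_box//; last 2 first.
- by apply/(measurable_restrictT _ mB); exact/measurable_EFinP.
- move=> x; rewrite patchE; case: ifPn => // /[!inE] Dx.
  by rewrite lee_fin ltW//; apply: prodf_gt0 Dx.
rewrite -[RHS](f1 ord0); apply: eq_integral => t /[!inE] Dt.
transitivity (\int[leb d]_(y in box (tailD D))
    ((f ord0 t)%:E * (prodf (fun i => f (lift ord0 i)) y)%:E))%E.
  apply: eq_integral => y /[!inE] Dy; rewrite patchE ifT.
    by rewrite /= prodf_consR EFinM.
  by rewrite inE; apply/box_consR.
rewrite ge0_integralZl//.
- by rewrite IHd// mule1.
- exact: measurable_box.
- exact/measurable_EFinP.
- by move=> y Dy; rewrite lee_fin ltW// p0.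
- by rewrite lee_fin ltW// f0.
Qed.

(** By independence, every marginal is its own factor and conditioning on the first coordinate
    merely removes that factor. The reference map is thus itself a Rosenblatt map, and its uniform
    image is a case of the general result. *)
Lemma rosenblatt_prodf d (D : 'I_d -> set R) (f : 'I_d -> R -> R) x :
  (forall i, measurable (D i : set (measurableTypeR R))) ->
  product_density D f -> box D x -> rosenblatt D (prodf f) x = cdf_map D f x.
Proof.
elim: d D f x => [|d IHd] D f x mD [mf f0 f1] Dx; first by rewrite [LHS]tuple0 [RHS]tuple0.
have [Dx0 Dx1] : D ord0 (thead x) /\ box (tailD D) [tuple of behead x].
  by move: Dx; rewrite -{1}(splitRK x) => /box_consR.
have pf1 : product_density (tailD D) (fun i => f (lift ord0 i)).
  by split => // i t; exact: f0.
have p0 := prodf_gt0 (D := tailD D) (fun i => f0 (lift ord0 i)).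
have mpt : measurable_fun (box (tailD D)) (prodf (fun i => f (lift ord0 i))).
  by apply: measurable_prodf => i; [exact: mD|exact: mf].
have m1E t : D ord0 t -> marginal1 D (prodf f) t = f ord0 t.
  move=> Dt; rewrite marginal1E /marginal1e.
  under eq_integral do rewrite prodf_consR EFinM.
  rewrite /=.
  rewrite ge0_integralZl//.
  - by rewrite integral_prodf//= mulr1.
  - exact: measurable_box.
  - exact/measurable_EFinP.
  - by move=> y Dy; rewrite lee_fin ltW// p0.
  - by rewrite lee_fin ltW// f0.
transitivity (consR (density_cdf (D ord0) (f ord0) (thead x),
    cdf_map (tailD D) (fun i => f (lift ord0 i)) [tuple of behead x])).
  rewrite -IHd// -(@eq_rosenblatt _ _ _ (conditional1 D (prodf f) (thead x)))//; last first.
    move=> y Dy; rewrite /conditional1 prodf_consR m1E//= mulrC mulKf//.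
    by rewrite gt_eqF// f0.
  congr consR; congr pair.
  by congr fine; apply: eq_integral => t /[!inE] -[Dt _]; rewrite m1E.
apply: eq_from_tnth => i; rewrite [RHS]tnth_mktuple.
have [j ->|->] := unliftP ord0 i; last by [].
rewrite tnth_consRS tnth_mktuple; congr density_cdf.
by rewrite -[in RHS](splitRK x) tnth_consRS.
Qed.

Lemma transports_cdf_map d (D : 'I_d -> set R) (f : 'I_d -> R -> R) :
  (forall i, measurable (D i : set (measurableTypeR R))) ->
  product_density D f ->
  transports (leb d) (box D) (prodf f) (leb d) (@cube R d) (fun=> 1) (cdf_map D f).
Proof.
move=> mD pf; have [mf f0 f1] := pf.
have rE x : box D x -> rosenblatt D (prodf f) x = cdf_map D f x by exact: rosenblatt_prodf.
have [||mr rC rI] := transports_rosenblatt mD (measurable_prodf mD mf).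
- by move=> x Dx; rewrite ltW//; apply: prodf_gt0 Dx.
- exact: integral_prodf.
split.
- by apply: eq_measurable_fun mr => x /[!inE] /rE.
- by move=> x Dx; rewrite -rE//; exact: rC.
- move=> h mh h0; rewrite -rI//; apply: eq_integral => x /[!inE] Dx.
  by rewrite rE.
Qed.

End product_densities.

(** * Layers of the DIRT construction *)

Section weights.
Context d (T : measurableType d) (R : realType) (mu : {measure set T -> \bar R}).
Variables (D : set T) (w : T -> R).
Hypotheses (mD : measurable D) (mw : measurable_fun D w).
Hypothesis w0 : forall x, D x -> 0 < w x.

(** A positive weight has integral 0 only on a null domain, where the integral of [v] would vanish
    too. The witness [v] will be [pi0 * lambda] on X and [f_U] on U. *)
Lemma integral_weight_gt0 (v : T -> R) :
  measurable_fun D v -> (forall x, D x -> 0 <= v x) ->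
  (\int[mu]_(x in D) (v x)%:E != 0)%E -> (0 < \int[mu]_(x in D) (w x)%:E)%E.
Proof.
move=> mv v0 vn0; rewrite lt_neqAle integral_ge0 ?andbT; last first.
  by move=> x Dx; rewrite lee_fin ltW// w0.
apply: contra vn0 => /eqP /esym W0.
have mwE : measurable_fun D (EFin \o w) by exact/measurable_EFinP.
have : (\int[mu]_(x in D) `|(w x)%:E| = 0)%E.
  rewrite -W0; apply: eq_integral => x /[!inE] Dx.
  by rewrite gee0_abs// lee_fin ltW// w0.
move/(ae_eq_integral_abs mu mD mwE) => aew.
rewrite (_ : 0%E = \int[mu]_(x in D) (0 : \bar R))%E; last by rewrite integral0.
apply/eqP; apply: ge0_ae_eq_integral => //.
- exact/measurable_EFinP.
- apply: ae_imply aew => x wx Dx.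
  by have := w0 Dx; have [->] := wx Dx; rewrite ltxx.
Qed.

Lemma Rintegral_weight_gt0 (v : T -> R) :
  measurable_fun D v -> (forall x, D x -> 0 <= v x) ->
  (\int[mu]_(x in D) (v x)%:E != 0)%E -> (\int[mu]_(x in D) (w x)%:E < +oo)%E ->
  0 < \int[mu]_(x in D) w x.
Proof.
move=> mv v0 vn0 woo; have := integral_weight_gt0 mv v0 vn0.
rewrite /Rintegral; move: woo.
by case: (\int[mu]_(x in D) (w x)%:E)%E.
Qed.

End weights.

Lemma measurable_fun_sqrt d (T : measurableType d) (R : realType) (D : set T) (f : T -> R) :
  measurable_fun D f -> measurable_fun D (fun x => Num.sqrt (f x)).
Proof.
move=> mf; have ms : measurable_fun setT (Num.sqrt : R -> R).
  by apply: continuous_measurable_fun; exact: sqrt_continuous.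
exact: (measurableT_comp ms mf).
Qed.

(** With [s] the root, the right side minus the left side is [2 * q * (s - g)]; both factors are
    nonnegative, whatever the sign of [g]. *)
Lemma sqr_diff_sqrt_le (R : rcfType) (q g c : R) : 0 <= q -> 0 <= c ->
  (q - Num.sqrt (c + g ^+ 2)) ^+ 2 <= (g - q) ^+ 2 + c.
Proof.
move=> q0 c0; have C0 : 0 <= c + g ^+ 2 by rewrite addr_ge0// sqr_ge0.
have gs : g <= Num.sqrt (c + g ^+ 2).
  by rewrite (le_trans (ler_norm g))// -sqrtr_sqr ler_wsqrtr// lerDr.
have := sqr_sqrtr C0; set s := Num.sqrt _ in gs *.
have := ler_wpM2l q0 gs; nra.
Qed.

(** Pointwise change of variables, with [a], [b], [C], [f], [w] standing for [pi_k], [pihat_(k-1)],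
    [gamma_k + g_k ^+ 2], [f_U], [omega]. Both roots on the left contain the factor [e], whose
    square times [f / b] is [w]; what remains of the first root is [q_k]. *)
Lemma sqr_diff_sqrt_ratio (R : rcfType) (a b C f w : R) :
  0 <= a -> 0 < b -> 0 <= C -> 0 < f -> 0 < w ->
  (Num.sqrt a - Num.sqrt (b * (C * w / f))) ^+ 2 * f / b =
  (Num.sqrt (a / b * (f / w)) - Num.sqrt C) ^+ 2 * w.
Proof.
move=> a0 b0 C0 f0 w0; pose e := Num.sqrt (b * w / f).
have e2 : e ^+ 2 = b * w / f by rewrite sqr_sqrtr// divr_ge0 ?mulr_ge0// ltW.
have [bn0 fn0 wn0] : [/\ b != 0, f != 0 & w != 0] by rewrite !gt_eqF.
have -> : Num.sqrt (b * (C * w / f)) = Num.sqrt C * e.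
  by rewrite -sqrtrM//; congr Num.sqrt; field.
have -> : Num.sqrt a = Num.sqrt (a / b * (f / w)) * e.
  rewrite /e -sqrtrM; last by rewrite mulr_ge0// divr_ge0// ltW.
  by congr Num.sqrt; field; rewrite wn0 bn0 fn0.
rewrite -mulrBl exprMn e2; field.
by rewrite bn0 fn0.
Qed.

Lemma transports_inverse_rosenblatt (R : realType) d (D : 'I_d -> set R) (p : vec R d -> R) T :
  (forall i, measurable (D i : set (measurableTypeR R))) ->
  measurable_fun (box D) p -> (forall x, box D x -> 0 <= p x) ->
  (\int[leb d]_(x in box D) (p x)%:E = 1)%E ->
  inverse_rosenblatt D p T ->
  transports (leb d) (@cube R d) (fun=> 1) (leb d) (box D) p T.
Proof.
move=> mD mp p0 p1 [mT TD TK _].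
exact: (transports_left_inverse (measurable_box mD) (@measurable_cube R d) mp p0
  (transports_rosenblatt mD mp p0 p1) mT TD TK).
Qed.

Section sq_density.
Context (R : realType) d (D : set (vec R d)) (w g : vec R d -> R) (c : R).
Hypotheses (mD : measurable D) (mw : measurable_fun D w) (w0 : forall x, D x -> 0 < w x).
Hypothesis woo : (\int[leb d]_(x in D) (w x)%:E < +oo)%E.
Hypothesis Rw0 : 0 < \int[leb d]_(x in D) w x.
Hypotheses (c0 : 0 < c) (mg : measurable_fun D g).
Hypothesis goo : (\int[leb d]_(x in D) (g x ^+ 2 * w x)%:E < +oo)%E.

Lemma measurable_sq_density : measurable_fun D (sq_density w c g).
Proof.
apply: measurable_funM => //; apply: measurable_funD => //.
exact: measurable_funX.
Qed.

Lemma sq_density_gt0 x : D x -> 0 < sq_density w c g x.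
Proof. by move=> Dx; rewrite mulr_gt0 ?w0// ltr_pwDl// sqr_ge0. Qed.

Lemma sq_mass_gt0 : 0 < sq_mass D w c g.
Proof.
rewrite /sq_mass ltr_pwDl ?mulr_gt0//; apply: fine_ge0; apply: integral_ge0 => x Dx.
by rewrite lee_fin mulr_ge0 ?sqr_ge0// ltW// w0.
Qed.

Lemma integral_sq_density :
  (\int[leb d]_(x in D) (sq_density w c g x)%:E = (sq_mass D w c g)%:E)%E.
Proof.
have mgw : measurable_fun D (fun x => g x ^+ 2 * w x).
  by apply: measurable_funM => //; exact: measurable_funX.
have gw0 x : D x -> 0 <= g x ^+ 2 * w x.
  by move=> Dx; rewrite mulr_ge0 ?sqr_ge0// ltW// w0.
transitivity (\int[leb d]_(x in D) (c%:E * (w x)%:E + (g x ^+ 2 * w x)%:E))%E.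
  by apply: eq_integral => x _; rewrite -EFinM -EFinD -mulrDl.
rewrite ge0_integralD//.
- rewrite ge0_integralZl//.
  + rewrite /sq_mass EFinD EFinM /Rintegral !fineK//.
    * by rewrite ge0_fin_numE// integral_ge0// => x Dx; rewrite lee_fin gw0.
    * by rewrite ge0_fin_numE// integral_ge0// => x Dx; rewrite lee_fin ltW// w0.
  + exact/measurable_EFinP.
  + by move=> x Dx; rewrite lee_fin ltW// w0.
  + by rewrite lee_fin ltW.
- by move=> x Dx; rewrite -EFinM lee_fin mulr_ge0// ltW// w0.
- by apply: emeasurable_funM => //; exact/measurable_EFinP.
- exact/measurable_EFinP.
Qed.

Let Z := sq_mass D w c g.

Lemma integral_normalized_sq_density :
  (\int[leb d]_(x in D) (Z^-1 * sq_density w c g x)%:E = 1)%E.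
Proof.
under eq_integral do rewrite EFinM.
rewrite ge0_integralZl//.
- by rewrite integral_sq_density -EFinM mulVf// gt_eqF// sq_mass_gt0.
- by apply/measurable_EFinP; exact: measurable_sq_density.
- by move=> x Dx; rewrite lee_fin ltW// sq_density_gt0.
- by rewrite lee_fin invr_ge0 ltW// sq_mass_gt0.
Qed.

End sq_density.

Section dirt_transport.
Context (R : realType) (d : nat) (M : dirt R d) (L : nat).
Hypothesis hS : dirt_setting M L.
(* A bridging density is needed only to know that boxX is not a null set, without
   which zhat 0 = 0. *)
Variable pi0 : vec R d -> R.
Hypothesis hpi0 : bridging_density M pi0.

Let X := boxX M.
Let U := boxU M.
Let lam := lambdaX M.
Let om := omegaU M.
Let fu := fU M.

Let mDX i : measurable (domX M i : set (measurableTypeR R)).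
Proof. by have [[+ _] _ _ _ _] := hS; exact. Qed.

Let mDU i : measurable (domU M i : set (measurableTypeR R)).
Proof. by have [[_ +] _ _ _ _] := hS; exact. Qed.

Lemma measurable_boxX : measurable X. Proof. exact: measurable_box. Qed.
Lemma measurable_boxU : measurable U. Proof. exact: measurable_box. Qed.

Lemma measurable_lambdaX : measurable_fun X lam.
Proof. by have [_ [[mw _ _] _] _ _ _] := hS; exact: measurable_prodf. Qed.

Lemma measurable_omegaU : measurable_fun U om.
Proof. by have [_ [_ [mw _ _]] _ _ _] := hS; exact: measurable_prodf. Qed.

Lemma measurable_fU : measurable_fun U fu.
Proof. by have [_ _ [mw _ _] _ _] := hS; exact: measurable_prodf. Qed.

Lemma lambdaX_gt0 x : X x -> 0 < lam x.
Proof. by have [_ [[_ w0 _] _] _ _ _] := hS; exact: prodf_gt0. Qed.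

Lemma omegaU_gt0 u : U u -> 0 < om u.
Proof. by have [_ [_ [_ w0 _]] _ _ _] := hS; exact: prodf_gt0. Qed.

Lemma fU_gt0 u : U u -> 0 < fu u.
Proof. by have [_ _ [_ w0 _] _ _] := hS; exact: prodf_gt0. Qed.

Let lam_oo : (\int[leb d]_(x in X) (lam x)%:E < +oo)%E.
Proof. by have [_ [[_ _ +] _] _ _ _] := hS. Qed.

Lemma integral_omegaU_lty : (\int[leb d]_(u in U) (om u)%:E < +oo)%E.
Proof. by have [_ [_ [_ _ +]] _ _ _] := hS. Qed.

Let lam_gt0 : 0 < \int[leb d]_(x in X) lam x.
Proof.
have [mpi pi_ge0 /andP[pi_gt0 _]] := hpi0.
apply: (Rintegral_weight_gt0 measurable_boxX measurable_lambdaX lambdaX_gt0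
  (v := fun x => pi0 x * lam x)) => //.
- by apply: measurable_funM => //; exact: measurable_lambdaX.
- by move=> x Xx; rewrite mulr_ge0 ?pi_ge0// ltW// lambdaX_gt0.
- by rewrite gt_eqF.
Qed.

Lemma Rintegral_omegaU_gt0 : 0 < \int[leb d]_(u in U) om u.
Proof.
apply: (Rintegral_weight_gt0 measurable_boxU measurable_omegaU omegaU_gt0 (v := fu)).
- exact: measurable_fU.
- by move=> u Uu; rewrite ltW// fU_gt0.
- have [_ _ pf _ _] := hS; rewrite integral_prodf//.
- exact: integral_omegaU_lty.
Qed.

Lemma gam_gt0 j : (j <= L)%N -> 0 < gam M j.
Proof. by have [_ _ _ hl _] := hS; case: j => [|j] /hl []. Qed.

Lemma measurable_gtt0 : measurable_fun X (gtt M 0).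
Proof. by have [_ _ _ /(_ 0%N isT)[_ [_ + _] _] _] := hS. Qed.

Lemma measurable_gttS j : (j < L)%N -> measurable_fun U (gtt M j.+1).
Proof. by move=> jL; have [_ _ _ /(_ j.+1 jL)[_ [_ + _] _] _] := hS. Qed.

Lemma zhat_gt0 j : (j <= L)%N -> 0 < zhat M j.
Proof.
move=> jL; have g0 := gam_gt0 jL; case: j jL g0 => [|j] jL g0.
  exact: (sq_mass_gt0 (D := X) _ lambdaX_gt0 lam_gt0).
exact: (sq_mass_gt0 (D := U) _ omegaU_gt0 Rintegral_omegaU_gt0).
Qed.

Lemma zbar_gt0 j : (j <= L)%N -> 0 < zbar M j.
Proof.
move=> jL; rewrite /zbar big_mkord; apply: prodr_gt0 => i _; apply: zhat_gt0.
by rewrite (leq_trans _ jL)// -ltnS.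
Qed.

Lemma zbarS j : zbar M j.+1 = zbar M j * zhat M j.+1.
Proof. by rewrite /zbar big_nat_recr. Qed.

Lemma pihatS j x : pihat M j.+1 x = pihat M j x *
  ((gam M j.+1 + gtt M j.+1 (Tbar_inv M j x) ^+ 2) * om (Tbar_inv M j x)
   / fu (Tbar_inv M j x)).
Proof. by rewrite /pihat big_nat_recr//= mulrA. Qed.

Lemma measurable_Tbar_inv j : (j <= L)%N -> measurable_fun X (Tbar_inv M j).
Proof. by have [_ _ _ _ hi] := hS; move=> /hi[]. Qed.

Lemma Tbar_inv_boxU j x : (j <= L)%N -> X x -> U (Tbar_inv M j x).
Proof. by have [_ _ _ _ hi] := hS; move=> /hi[_ + _ _]; exact. Qed.

Lemma Tbar_invK j : (j <= L)%N ->
  {ae leb d, forall u, U u -> Tbar_inv M j (Tbar M j u) = u}.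
Proof. by have [_ _ _ _ hi] := hS; move=> /hi[]. Qed.

Lemma measurable_comp_Tbar_inv j (h : vec R d -> R) : (j <= L)%N ->
  measurable_fun U h -> measurable_fun X (fun x => h (Tbar_inv M j x)).
Proof.
move=> jL mh; apply: (measurable_comp measurable_boxU _ mh (measurable_Tbar_inv jL)).
by move=> _ [x Xx <-]; exact: Tbar_inv_boxU.
Qed.

Lemma measurable_pihat j : (j <= L)%N -> measurable_fun X (pihat M j).
Proof.
elim: j => [|j IHj] jL.
  rewrite /pihat; apply: measurable_funM.
    by apply: measurable_funD => //; apply: measurable_funX; exact: measurable_gtt0.
  by under eq_fun do rewrite big_geq//; exact: measurable_cst.
rewrite (_ : pihat M j.+1 = fun x => pihat M j x *
    ((gam M j.+1 + gtt M j.+1 (Tbar_inv M j x) ^+ 2) * om (Tbar_inv M j x)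
     / fu (Tbar_inv M j x))); last by apply/funext => x; exact: pihatS.
apply: measurable_funM; first by apply: IHj; exact: ltnW.
apply: (measurable_comp_Tbar_inv (h := fun u =>
  (gam M j.+1 + gtt M j.+1 u ^+ 2) * om u / fu u) (ltnW jL)).
apply: measurable_funM; last by apply: measurable_fun_inv; exact: measurable_fU.
apply: measurable_funM; last exact: measurable_omegaU.
by apply: measurable_funD => //; apply: measurable_funX; exact: measurable_gttS.
Qed.

Lemma pihat_gt0 j x : (j <= L)%N -> X x -> 0 < pihat M j x.
Proof.
elim: j => [|j IHj] jL Xx.
  by rewrite /pihat big_geq// mulr1 ltr_pwDl ?gam_gt0// sqr_ge0.
have UT := Tbar_inv_boxU (ltnW jL) Xx.
rewrite pihatS; apply: mulr_gt0; first exact: IHj (ltnW jL) Xx.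
apply: divr_gt0; last exact: fU_gt0.
apply: mulr_gt0; last exact: omegaU_gt0.
by rewrite ltr_pwDl ?gam_gt0// sqr_ge0.
Qed.

Let refmap_uniform : transports (leb d) U fu (leb d) (@cube R d) (fun=> 1) (refmap M).
Proof. by have [_ _ pf _ _] := hS; exact: transports_cdf_map. Qed.

Lemma transports_layer0 :
  transports (leb d) U fu (leb d) X
    (fun x => (zhat M 0)^-1 * sq_density lam (gam M 0) (gtt M 0) x) (Tbar M 0).
Proof.
have g0 := gam_gt0 (leq0n L); have z0 := zhat_gt0 (leq0n L).
have [_ _ _ /(_ 0%N isT)[_ [_ mg goo] hT] _] := hS.
apply: (transports_comp (@measurable_cube R d) measurable_boxX refmap_uniform).
apply: transports_inverse_rosenblatt => //.
- apply: measurable_funM => //.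
  by apply: measurable_sq_density => //; exact: measurable_lambdaX.
- move=> x Xx; rewrite mulr_ge0// ?invr_ge0 ltW//.
  exact: (sq_density_gt0 _ lambdaX_gt0).
- apply: (integral_normalized_sq_density measurable_boxX
    measurable_lambdaX lambdaX_gt0) => //.
Qed.

Lemma transports_layerS j : (j < L)%N ->
  transports (leb d) U fu (leb d) U
    (fun u => (zhat M j.+1)^-1 * sq_density om (gam M j.+1) (gtt M j.+1) u)
    (That M j.+1 \o refmap M).
Proof.
move=> jL; have g0 := gam_gt0 jL; have z0 := zhat_gt0 jL.
have [_ _ _ /(_ j.+1 jL)[_ [_ mg goo] hT] _] := hS.
apply: (transports_comp (@measurable_cube R d) measurable_boxU refmap_uniform).
apply: transports_inverse_rosenblatt => //.
- apply: measurable_funM => //.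
  by apply: measurable_sq_density => //; exact: measurable_omegaU.
- move=> x Ux; rewrite mulr_ge0// ?invr_ge0 ltW//.
  exact: (sq_density_gt0 _ omegaU_gt0).
- apply: (integral_normalized_sq_density measurable_boxU
    measurable_omegaU omegaU_gt0) => //.
  + exact: integral_omegaU_lty.
  + exact: Rintegral_omegaU_gt0.
Qed.

(** [Tbar j.+1] applies layer [j.+1] first, so the induction hypothesis for [Tbar j] must be fed
    that layer's density in place of [f_U]; reweighting achieves this. *)
Lemma transports_Tbar j : (j <= L)%N ->
  transports (leb d) U fu (leb d) X (fun x => pihat M j x * lam x / zbar M j) (Tbar M j).
Proof.
elim: j => [|j IHj] jL.
  apply: (eq_transports _ _ transports_layer0) => // x _.
  rewrite /sq_density /pihat big_geq// mulr1 /zbar big_nat1.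
  by rewrite mulrC.
apply: (transports_comp measurable_boxU measurable_boxX (transports_layerS jL)).
(* The density of the new layer relative to [f_U]. Composed with [Tbar_inv M j], it is the new
   factor of [pihat] divided by [zhat M j.+1]. *)
pose r u := (zhat M j.+1)^-1 * sq_density om (gam M j.+1) (gtt M j.+1) u / fu u.
have mr : measurable_fun U r.
  apply: measurable_funM; last by apply: measurable_fun_inv; exact: measurable_fU.
  apply: measurable_funM => //.
  by apply: measurable_sq_density; [exact: measurable_omegaU|exact: measurable_gttS].
have r0 u : U u -> 0 <= r u.
  move=> Uu; rewrite divr_ge0//; last by rewrite ltW// fU_gt0.
  rewrite mulr_ge0// ?invr_ge0 ltW ?zhat_gt0//.
  by apply: (sq_density_gt0 _ omegaU_gt0) => //; exact: gam_gt0.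
have fu0 u : U u -> 0 <= fu u by move=> Uu; rewrite ltW// fU_gt0.
have := transports_reweight measurable_boxU measurable_boxX measurable_fU fu0
  (IHj (ltnW jL)) (measurable_Tbar_inv (ltnW jL))
  (fun x => Tbar_inv_boxU (ltnW jL)) (Tbar_invK (ltnW jL)) mr r0.
apply: eq_transports => [u /[!inE] Uu|x _].
  by rewrite /r divfK// gt_eqF// fU_gt0.
rewrite pihatS zbarS /r /sq_density invfM; ring.
Qed.

(** * Error of the exact ratio approach; the approximated layer is [k.+1] *)

Section exact_ratio_error.
Variables (k : nat) (pik : vec R d -> R).
Hypotheses (kL : (k < L)%N) (hpik : bridging_density M pik).
Local Notation g := (gtt M k.+1).
Local Notation q := (exact_ratio M pik k.+1).
Local Notation T := (Tbar M k).

Let err := (\int[leb d]_(u in U) ((g u - q u) ^+ 2 * om u)%:E)%E.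

Let kL' : (k <= L)%N. Proof. exact: ltnW. Qed.

Let measurable_comp_T (h : vec R d -> R) :
  measurable_fun X h -> measurable_fun U (fun u => h (T u)).
Proof.
have [mT TX _] := transports_Tbar kL'; move=> mh.
by apply: (measurable_comp measurable_boxX _ mh mT) => _ [u Uu <-]; exact: TX.
Qed.

Let mq : measurable_fun U q.
Proof.
have [mpi _ _] := hpik; apply: measurable_fun_sqrt; apply: measurable_funM.
  apply: measurable_funM; first exact: measurable_comp_T.
  exact: measurable_fun_inv (measurable_comp_T (measurable_pihat kL')).
apply: measurable_funM; first exact: measurable_fU.
by apply: measurable_fun_inv; exact: measurable_omegaU.
Qed.

(** The bound is kept in extended reals, before any use of [eps] or of the choice of [gamma_k],
    since the finiteness of [err] comes only from the bound by [eps]. *)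
Lemma sq_error_le :
  (\int[leb d]_(x in X) ((Num.sqrt (pik x) - Num.sqrt (pihat M k.+1 x)) ^+ 2 * lam x)%:E
   <= (zbar M k)%:E * (err + (gam M k.+1 * \int[leb d]_(u in U) om u)%:E))%E.
Proof.
have [mpi pi0' _] := hpik.
have z0 := zbar_gt0 kL'; have [mT TX IT] := transports_Tbar kL'.
have g0 := gam_gt0 kL.
(* The squared error divided by the density [pihat_k lambda / zbar_k]; [lambda] cancels between the
   two. *)
pose h x := (Num.sqrt (pik x) - Num.sqrt (pihat M k.+1 x)) ^+ 2 * zbar M k / pihat M k x.
have mh : measurable_fun X h.
  apply: measurable_funM; last by apply/measurable_fun_inv; exact: measurable_pihat.
  apply: measurable_funM => //; apply: measurable_funX; apply: measurable_funB.
    exact: measurable_fun_sqrt.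
  by apply: measurable_fun_sqrt; exact: measurable_pihat.
have h0 x : X x -> 0 <= h x.
  move=> Xx; have p0 := pihat_gt0 kL' Xx.
  by rewrite /h divr_ge0 ?(ltW p0)// mulr_ge0 ?sqr_ge0// (ltW z0).
rewrite [leLHS](_ : _ =
    \int[leb d]_(x in X) ((h x)%:E * (pihat M k x * lam x / zbar M k)%:E))%E; last first.
  apply: eq_integral => x /[!inE] Xx; rewrite -EFinM; congr EFin.
  have := pihat_gt0 kL' Xx; rewrite /h => p0.
  by field; rewrite !gt_eqF.
rewrite -(IT (EFin \o h))//=; last exact/measurable_EFinP.
have mgq : measurable_fun U (fun u => (g u - q u) ^+ 2 * om u).
  apply: measurable_funM; last exact: measurable_omegaU.
  by apply: measurable_funX; apply: measurable_funB => //; exact: measurable_gttS.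
have gq0 u : U u -> 0 <= (g u - q u) ^+ 2 * om u.
  by move=> Uu; rewrite mulr_ge0 ?sqr_ge0// ltW// omegaU_gt0.
have Iom : (\int[leb d]_(u in U) (om u)%:E = (\int[leb d]_(u in U) om u)%:E)%E.
  rewrite /Rintegral fineK// ge0_fin_numE ?integral_omegaU_lty// integral_ge0// => u Uu.
  by rewrite lee_fin ltW// omegaU_gt0.
have mU := measurable_boxU.
pose F u := zbar M k * ((g u - q u) ^+ 2 * om u + gam M k.+1 * om u).
have -> : ((zbar M k)%:E * (err + (gam M k.+1 * \int[leb d]_(u in U) om u)%:E) =
    \int[leb d]_(u in U) (F u)%:E)%E.
  have FE u : (F u)%:E = ((zbar M k)%:E *
      (((g u - q u) ^+ 2 * om u)%:E + (gam M k.+1)%:E * (om u)%:E))%E.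
    by rewrite /F (EFinM (zbar M k)) EFinD (EFinM (gam M k.+1)).
  under eq_integral do rewrite FE.
  rewrite ge0_integralZl//.
  + rewrite ge0_integralD//.
    * rewrite ge0_integralZl//.
      - by rewrite Iom.
      - by apply/measurable_EFinP; exact: measurable_omegaU.
      - by move=> u Uu; rewrite lee_fin ltW// omegaU_gt0.
      - by rewrite lee_fin ltW.
    * exact/measurable_EFinP.
    * by move=> u Uu; rewrite -EFinM lee_fin mulr_ge0// ltW// omegaU_gt0.
    * by apply: emeasurable_funM => //; apply/measurable_EFinP; exact: measurable_omegaU.
  + apply: emeasurable_funD; first exact/measurable_EFinP.
    by apply: emeasurable_funM => //; apply/measurable_EFinP; exact: measurable_omegaU.
  + move=> u Uu; rewrite -EFinM -EFinD lee_fin addr_ge0 ?gq0// mulr_ge0// ltW//.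
    exact: omegaU_gt0.
  + by rewrite lee_fin ltW.
apply: ae_ge0_le_integral.
- exact: mU.
- move=> u Uu; apply: mule_ge0; rewrite lee_fin; first exact/h0/TX.
  exact: ltW (fU_gt0 Uu).
- apply: emeasurable_funM; apply/measurable_EFinP; last exact: measurable_fU.
  exact: measurable_comp_T.
- move=> u Uu; rewrite lee_fin mulr_ge0 ?addr_ge0 ?gq0 ?mulr_ge0// ltW//.
  exact: omegaU_gt0.
- apply/measurable_EFinP; apply: measurable_funM => //; apply: measurable_funD => //.
  by apply: measurable_funM => //; exact: measurable_omegaU.
(* [pihat M k.+1 (T u)] evaluates [g], [om] and [fu] at [Tbar_inv M k (T u)], which is [u] only
   almost everywhere. *)
apply: ae_imply (Tbar_invK kL') => u TKu Uu; have {}TKu := TKu Uu.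
have Xx := TX _ Uu; rewrite -EFinM lee_fin /h /F pihatS TKu.
have b0 := pihat_gt0 kL' Xx; have f0 := fU_gt0 Uu; have w0 := omegaU_gt0 Uu.
have C0 : 0 <= gam M k.+1 + g u ^+ 2 by rewrite addr_ge0 ?sqr_ge0// ltW.
have := sqr_diff_sqrt_ratio (pi0' _ Xx) b0 C0 f0 w0.
rewrite -[Num.sqrt (pik (T u) / _ * _)]/(q u) => E.
have := sqr_diff_sqrt_le (g u) (sqrtr_ge0 _ : 0 <= q u) (ltW g0) => le1.
rewrite (_ : _ * fu u = zbar M k * ((q u - Num.sqrt (gam M k.+1 + g u ^+ 2)) ^+ 2 * om u)).
  rewrite ler_pM2l// -mulrDl ler_pM2r//.
rewrite -E; field; rewrite gt_eqF//.
Qed.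

End exact_ratio_error.

End dirt_transport.

Theorem theorem3 (R : realType) (d : nat) (hd : (0 < d)%N) (L : nat)
    (M : dirt R d) (hS : dirt_setting M L)
    (pi_ : nat -> d.-tuple (measurableTypeR R) -> R)
    (hpi : forall k, (k <= L)%N -> bridging_density M (pi_ k))
    (k : nat) (hk : (1 <= k <= L)%N) (eps : R)
    (heps : (L2norm (boxU M) (omegaU M)
               (fun u => gtt M k u - exact_ratio M (pi_ k) k u)%R
             <= eps%:E)%E)
    (hgam : ((gam M k)%:E
             <= ((\int[leb d]_(u in boxU M) omegaU M u)^-1)%:E
                * L2norm (boxU M) (omegaU M)
                    (fun u => gtt M k u - exact_ratio M (pi_ k) k u)%R ^+ 2)%E) :
  (L2norm (boxX M) (lambdaX M)
     (fun x => Num.sqrt (pi_ k x) - Num.sqrt (pihat M k x))%R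
   <= (Num.sqrt (2 * zbar M k.-1) * eps)%:E)%E.
Proof.
have hpi0 := hpi 0%N (leq0n L).
case: k hk heps hgam => [//|k] /andP[_ kL] heps hgam; rewrite -[k.+1.-1]/k.
have W0 := Rintegral_omegaU_gt0 hS.
have z0 : 0 < zbar M k by exact: (zbar_gt0 hS hpi0 (ltnW kL)).
have le_err := sq_error_le hS hpi0 kL (hpi _ kL).
move: heps hgam le_err; rewrite /L2norm.
set err := (\int[leb d]_(u in boxU M) _)%E.
set W := (X in (_ * X)%:E) => heps hgam le_err.
have err0 : (0 <= err)%E.
  apply: integral_ge0 => u Uu.
  by rewrite lee_fin mulr_ge0 ?sqr_ge0// ltW// (omegaU_gt0 hS).
rewrite sqr_sqrte// in hgam.
(* The sign of [eps] follows from its bounding a norm. *)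
have eps0 : 0 <= eps by rewrite -lee_fin (le_trans (sqrte_ge0 err)).
have e2 : (err <= (eps ^+ 2)%:E)%E.
  by rewrite -(lee_sqrt _ _) ?lee_fin ?sqr_ge0//= sqrtr_sqr ger0_norm.
(* Since [eps] is real, [err] is finite and the rest is real arithmetic. *)
have fe : err \is a fin_num.
  by rewrite ge0_fin_numE// (le_lt_trans e2)// ltry.
move: (fineK fe) e2 hgam le_err => <-; rewrite -/W -EFinM -EFinD -EFinM !lee_fin.
set e := fine err => e2 hgam le_err.
have gW : gam M k.+1 * W <= e by rewrite -ler_pdivlMr// mulrC.
have -> : Num.sqrt (2 * zbar M k) * eps = Num.sqrt (2 * zbar M k * eps ^+ 2).
  by rewrite [RHS]sqrtrM ?mulr_ge0 ?(ltW z0)// sqrtr_sqr ger0_norm.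
rewrite -[leRHS]/(sqrte (2 * zbar M k * eps ^+ 2)%:E) lee_sqrt; last first.
  by rewrite lee_fin mulr_ge0 ?sqr_ge0// mulr_ge0// ltW.
apply: (le_trans le_err); rewrite lee_fin.
(* The misfit and the term from [gamma_k] are each at most [eps ^+ 2]; their sum gives the factor
   2. *)
have := ler_wpM2l (ltW z0) (lerD e2 (le_trans gW e2)); lra.
Qed.
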